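(* Let $n\ge2$ and let $P_u$, $u\in\overline{\mathbb{R}}=\mathbb{R}\cup\{\infty\}$, be a flexible cross-polytope in $\mathbb{S}^n$ with the following properties: (i) there is $\delta>0$ such that $P_u$ is embedded whenever $u\in(-\delta,\delta)$; (ii) $P_0$ is a homeomorphism of $K_n$ onto the equatorial great sphere $\mathbb{S}^{n-1}\subset\mathbb{S}^n$ mapping simplices onto spherical simplices; (iii) $P_u$ is contained in the open upper hemisphere $\mathbb{S}^n_+$ for $u>0$ and in the open lower hemisphere $\mathbb{S}^n_-$ for $u<0$ ($u\in\mathbb{R}$); (iv) $P_\infty$ is contained in $\mathbb{S}^{n-1}$ but is not embedded. Then the volume $V(P_u)$ is non-constant on every arbitrarily small interval of parameters $(0,u_0)$, $0<u_0\le\delta$. Consequently, for every $n\ge 2$ there exists an embedded flexible cross-polytope with non-constant volume in the open hemisphere $\mathbb{S}^n_+$.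
   Context: $\mathbb{S}^n$ is the unit sphere in $\mathbb{R}^{n+1}$; a $k$-dimensional plane in $\mathbb{S}^n$ is a $k$-dimensional great sphere. Fix a unit vector $\mathbf{m}\in\mathbb{R}^{n+1}$ (the northern pole); the equatorial great sphere is $\mathbb{S}^{n-1}=\{\mathbf{x}\in\mathbb{S}^n:\langle\mathbf{x},\mathbf{m}\rangle=0\}$, and $\mathbb{S}^n_{+}$, $\mathbb{S}^n_-$ are the open hemispheres $\langle\mathbf{x},\mathbf{m}\rangle>0$, $\langle\mathbf{x},\mathbf{m}\rangle<0$. $K_n$ is the simplicial complex with $2n$ vertices $\mathbf{a}_1,\dots,\mathbf{a}_n,\mathbf{b}_1,\dots,\mathbf{b}_n$ whose simplices are the sets of vertices containing no pair $\{\mathbf{a}_i,\mathbf{b}_i\}$. A non-degenerate polyhedron of combinatorial type $K_n$ (a cross-polytope) in $\mathbb{S}^n$ is a mapping $P\colon K_n\to\mathbb{S}^n$ such that: (1) for each simplex $[v_0\dots v_l]$ of $K_n$ the points $P(v_0),\dots,P(v_l)$ do not lie in an $(l-1)$-dimensional plane, and $P$ restricted to $[v_0\dots v_l]$ is a homeomorphism onto the convex hull of these points; (2) $K_n$ cannot be decomposed into the union of two subcomplexes $K',K''$ of dimension $n-1$ such that $P(K'\cap K'')$ is contained in an $(n-2)$-dimensional plane. $P$ is embedded if the mapping $P$ is an embedding. ''$P$ is contained in a set'' means that $P(K_n)$ is. A flexible cross-polytope is a continuous family of mappings $P_u\colon K_n\to\mathbb{S}^n$ such that: (1) for all but finitely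 many $u$, $P_u$ is a non-degenerate polyhedron of combinatorial type $K_n$; (2) the lengths of all edges of $P_u$ are constant as $u$ varies; (3) for any two sufficiently close $u_1\neq u_2$ the polyhedra $P_{u_1}$ and $P_{u_2}$ are not congruent (by an orientation-preserving isometry matching corresponding vertices). Volume: for embedded $P_u$ the surface divides $\mathbb{S}^n$ into two parts, whose volumes sum to the volume of $\mathbb{S}^n$ (so constancy of the volume does not depend on which part is chosen); for $0\le u<\delta$, $V(P_u)$ denotes the $n$-dimensional volume of the part containing the northern pole $\mathbf{m}$ (for $u>0$ with $\mathbf m$ on the surface this is understood as the part other than the one containing $\mathbb{S}^n_-$). *)

(* Defs.v *)
(* MathComp-Analysis: the reals are an arbitrary [R : realType]; points of
   R^(n+1) are row vectors. *)
From HB Require Import structures.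
From mathcomp Require Import all_boot all_order all_algebra.
From mathcomp Require Import all_classical all_reals all_analysis.
Set Implicit Arguments.
Unset Strict Implicit.
Unset Printing Implicit Defensive.
Import Order.TTheory GRing.Theory Num.Theory.
Import numFieldNormedType.Exports.
Local Open Scope classical_set_scope.
Local Open Scope ring_scope.

Section Sphere.
Context {R : realType} {N : nat}.
Implicit Types (x y m : 'rV[R]_N) (A : set 'rV[R]_N).

Definition dot x y : R := (x *m y^T) 0 0.

Definition sphere : set 'rV[R]_N := [set x | dot x x = 1].

Definition sdist x y : R := acos (dot x y).

Definition equator m : set 'rV[R]_N := [set x | sphere x /\ dot x m = 0].
Definition upper m : set 'rV[R]_N := [set x | sphere x /\ 0 < dot x m].
Definition lower m : set 'rV[R]_N := [set x | sphere x /\ dot x m < 0].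

(* For A in the sphere: A lies in a (d - 1)-dimensional great sphere, i.e. in
   the trace on the sphere of a linear subspace of dimension d. *)
Definition in_plane (d : nat) A : Prop :=
  exists L : {vspace 'rV[R]_N}, \dim L = d /\ forall x, A x -> x \in L.

(* The spherical convex hull of the points p i, i in s: the trace on the sphere
   of the convex cone they span (used for linearly independent points only). *)
Definition hull (I : finType) (p : I -> 'rV[R]_N) (s : {set I}) :
    set 'rV[R]_N :=
  [set y | sphere y /\ exists c : I -> R,
     (forall i, 0 <= c i) /\ y = \sum_(i in s) c i *: p i].

End Sphere.

(* The d-dimensional Lebesgue measure by Tonelli's theorem, integrating the
   measures of the sections over the first coordinate; it is only meaningful on
   Borel sets. *)
Fixpoint lebesgue_rV {R : realType} (d : nat) : set 'rV[R]_d -> \bar R :=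
  match d return set 'rV[R]_d -> \bar R with
  | 0 => fun A => (\1_A 0)%:E
  | d'.+1 => fun A =>
      (\int[@lebesgue_measure R]_t
         lebesgue_rV [set y : 'rV[R]_d' | A (row_mx (t%:M : 'rV[R]_1) y)])%E
  end.

(* The n-dimensional volume on the unit sphere of R^(n+1) is n + 1 times the
   Lebesgue measure of the cone over the set with apex at the origin. *)
Definition cone {R : realType} (N : nat) (A : set 'rV[R]_N) : set 'rV[R]_N :=
  [set z | exists (t : R) x, [/\ 0 < t, t <= 1, A x & z = t *: x]].

Definition sphere_volume {R : realType} (n : nat) (A : set 'rV[R]_n.+1) :
    \bar R :=
  (n.+1%:R%:E * lebesgue_rV (cone A))%E.

Definition homeo_onto {T U : topologicalType} (A : set T) (B : set U)
    (f : T -> U) : Prop :=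
  [/\ {within A, continuous f}, f @` A = B &
      exists g : U -> T,
        {within B, continuous g} /\ forall x, A x -> g (f x) = x].

Section CrossPolytope.
Context {R : realType} {n : nat}.

(* The vertex (0, i) is a_i and the vertex (1, i) is b_i. *)
Definition vertex : finType := ('I_2 * 'I_n)%type.

Definition simplex (s : {set vertex}) : bool :=
  (s != finset.set0) && [forall i : 'I_n, ~~ (((0, i) \in s) && ((1, i) \in s))].

(* The geometric realization of K_n: x e i is the barycentric coordinate of x
   with respect to the vertex (e, i). *)
Definition vsupport (x : 'M[R]_(2, n)) : {set vertex} :=
  [set v : vertex | x v.1 v.2 != 0]%SET.

Definition realK : set 'M[R]_(2, n) :=
  [set x : 'M[R]_(2, n) |
     [/\ forall e i, 0 <= x e i, \sum_(e < 2) \sum_(i < n) x e i = 1 &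
         simplex (vsupport x)]].

Definition vpoint (v : vertex) : 'M[R]_(2, n) := delta_mx v.1 v.2.

Definition face (s : {set vertex}) : set 'M[R]_(2, n) :=
  [set x : 'M[R]_(2, n) | realK x /\ vsupport x \subset s].

Definition subcomplex (C : {set {set vertex}}) : Prop :=
  (forall s, s \in C -> simplex s) /\
  (forall s t : {set vertex}, s \in C -> t \subset s -> t != finset.set0 -> t \in C).

(* simplices of K_n have dimension at most n - 1 *)
Definition full_dim (C : {set {set vertex}}) : Prop :=
  exists2 s, s \in C & #|s| = n.

Definition realC (C : {set {set vertex}}) : set 'M[R]_(2, n) :=
  [set x : 'M[R]_(2, n) | realK x /\ vsupport x \in C].

(* Only the values on realK of a map P : K_n -> S^n are relevant. *)
Implicit Types (P : 'M[R]_(2, n) -> 'rV[R]_n.+1) (m : 'rV[R]_n.+1).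

Definition vimage P (v : vertex) : 'rV[R]_n.+1 := P (vpoint v).

Definition surface P : set 'rV[R]_n.+1 := P @` realK.

(* The images of the l + 1 = #|s| vertices of s are not contained in an
   (l - 1)-dimensional great sphere. *)
Definition general_position P (s : {set vertex}) : Prop :=
  ~ in_plane #|s|.-1 (vimage P @` [set` s]).

Definition nondegenerate_polyhedron P : Prop :=
  [/\ surface P `<=` sphere,
      forall s, simplex s ->
        general_position P s /\ homeo_onto (face s) (hull (vimage P) s) P &
      forall C' C'' : {set {set vertex}},
        subcomplex C' -> subcomplex C'' -> full_dim C' -> full_dim C'' ->
        (forall s, simplex s -> (s \in C') || (s \in C'')) ->
        ~ in_plane n.-1 (P @` (realC C' `&` realC C''))].

Definition embedded P : Prop := homeo_onto realK (surface P) P.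

(* Orientation-preserving isometries of the sphere are restrictions of elements
   of SO(n + 1). *)
Definition congruent P Q : Prop :=
  exists A : 'M[R]_n.+1,
    [/\ A *m A^T = 1%:M, \det A = 1 &
        forall v, vimage Q v = vimage P v *m A].

Definition flexible {T : topologicalType} (D : set T)
    (P : T -> 'M[R]_(2, n) -> 'rV[R]_n.+1) : Prop :=
  [/\ {within D `*` realK, continuous (fun z => P z.1 z.2)} /\
      (forall u, D u -> surface (P u) `<=` sphere),
      finite_set [set u | D u /\ ~ nondegenerate_polyhedron (P u)],
      forall v w : vertex, v != w -> simplex [set v; w]%SET ->
        forall u1 u2, D u1 -> D u2 ->
          sdist (vimage (P u1) v) (vimage (P u1) w) =
          sdist (vimage (P u2) v) (vimage (P u2) w) &
      forall u, D u -> \forall u1 \near u & u2 \near u,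
        D u1 -> D u2 -> u1 <> u2 -> ~ congruent (P u1) (P u2)].

Definition off_surface P : set 'rV[R]_n.+1 := sphere `\` surface P.

(* For P in the open upper hemisphere, the lower hemisphere lies in the
   component of - m. *)
Definition far_part m P : set 'rV[R]_n.+1 :=
  off_surface P `\` connected_component (off_surface P) (- m).

Definition pole_part m P : set 'rV[R]_n.+1 :=
  if `[< surface P m >] then far_part m P
  else connected_component (off_surface P) m.

End CrossPolytope.

(* Main.v *)
Require Import Defs.
From HB Require Import structures.
From mathcomp Require Import all_boot all_order all_algebra.
From mathcomp Require Import all_classical all_reals all_analysis.
From mathcomp Require Import ring lra.
Set Implicit Arguments.
Unset Strict Implicit.
Unset Printing Implicit Defensive.
Import Order.TTheory GRing.Theory Num.Theory.
Import numFieldNormedType.Exports.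
Local Open Scope classical_set_scope.
Local Open Scope ring_scope.

(** The volume [V u] of the part of the sphere above the surface is less than
    half of the volume of the sphere for [u > 0], because the surface lies in
    the open upper hemisphere, and it tends to this half as the surface
    approaches the equator; so it is not constant near [u = 0].  Quantitatively:
    pick [u1] with the surface above some height [b > 0], then [u2] with the
    surface below the height [b / 2].  The part at [u1] lies in the cap of height
    at least [b], the part at [u2] contains the larger cap of height greater than
    [b / 2] ([volume_nonconstant], [sphere_volume_lt_caps]).  The comparison of
    the caps uses only that the iterated integral defining the volume is monotone
    and superadditive on arbitrary sets, so no measurability is involved.

    The one topological point is that the surface separates the poles, and for a
    polyhedron close to the equator this needs no separation theorem.  The cones
    over the faces of the equatorial polyhedron form a complete fan in the
    hyperplane of the equator, and the coordinates of a vector in this fan are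
    Lipschitz ([complete_fan_coordinates]): they are linear on each of finitely
    many closed cones.  Moving the vertices slightly therefore changes the
    identity map of the space by a contraction, and the resulting piecewise
    linear map, which fixes the pole, is a bi-Lipschitz homeomorphism
    ([perturbed_fan]).  The height of the preimage of a point is a continuous
    function which is positive at one pole, negative at the other and vanishes
    only on the cones over the surface ([perturbed_fan_separates]).

    For the existence statement, let [e i] be an orthonormal frame of the
    hyperplane of the equator.  Take the vertices [a_i = - e i] fixed, and let
    [b_j] be proportional to
    [off j + cosT (lam j * u) *: e j + sinT (lam j * u) *: m]: it rotates about
    the span of the other [a_i], the half-angle having the tangent [lam j * u].
    The scalar products of [b_i] and [b_j] are constant as soon as the
    coefficients of [off] are
    [gcoef i j = 2 * lam i * lam j / (lam i ^+ 2 - lam j ^+ 2)]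
    ([half_angle_flexion]), which are antisymmetric; this is a flexible
    cross-polytope of the simplest type.  If the [lam j] form a geometric
    progression with a large ratio, the coefficients are small and the flat
    position is close to the fan of the coordinate cross-polytope.  The
    perturbation argument then gives that all positions with [u] small are
    embedded and nondegenerate.  A tilt of order [u] of the whole figure lifts
    the [a_i] into the open upper hemisphere and leaves the [b_j] there
    ([ray_upper]), and the first part of the argument applies to the tilted
    family. *)

(** * The iterated Lebesgue measure as a set function *)

Section LowerIntegral.
Context {R : realType}.
Notation mu := (@lebesgue_measure R).
Local Open Scope ereal_scope.
Import HBNNSimple.

Lemma le_lower_integral (f g : R -> \bar R) :
  (forall x, 0 <= f x) -> (forall x, f x <= g x) ->
  \int[mu]_x f x <= \int[mu]_x g x.
Proof.
move=> f0 fg.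
have g0 x : 0 <= g x by exact: le_trans (fg x).
rewrite !ge0_integralTE//; apply: ereal_sup_le => _ [h hf <-].
by exists h => // x; exact: le_trans (fg x).
Qed.

(** For measurable functions this is an equality; for arbitrary ones the
    supremum over simple minorants is still superadditive, because a sum of
    minorants is a minorant of the sum. *)
Lemma lower_integral_superadditive (f g : R -> \bar R) :
  (forall x, 0 <= f x) -> (forall x, 0 <= g x) ->
  \int[mu]_x f x + \int[mu]_x g x <= \int[mu]_x (f x + g x).
Proof.
move=> f0 g0; have fg0 x : 0 <= f x + g x by exact: adde_ge0.
rewrite !ge0_integralTE//.
set A := ereal_sup _; set B := ereal_sup _; set C := ereal_sup _.
have key (h k : {nnsfun measurableTypeR R >-> R}) : (forall x, (h x)%:E <= f x) ->
    (forall x, (k x)%:E <= g x) -> sintegral mu h + sintegral mu k <= C.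
  move=> hf kg; apply: ereal_sup_ubound => /=.
  exists (add_nnsfun h k); first by move=> x /=; rewrite EFinD; exact: leeD.
  by rewrite -sintegralD.
have h00 (F : R -> \bar R) : (forall x, 0 <= F x) ->
    (forall x, (@nnsfun0 _ (measurableTypeR R) R x)%:E <= F x).
  by move=> F0 x; exact: F0.
have A0 : 0 <= A.
  by apply: ereal_sup_ubound; exists nnsfun0; [exact: h00|exact: sintegral0].
have B0 : 0 <= B.
  by apply: ereal_sup_ubound; exists nnsfun0; [exact: h00|exact: sintegral0].
have [->|Cfin] := eqVneq C +oo; first by rewrite leey.
have AC : A <= C.
  apply: ge_ereal_sup => _ [h hf <-].
  by have := key h nnsfun0 hf (h00 _ g0); rewrite sintegral0 adde0.
have Afin : A \is a fin_num.
  by rewrite ge0_fin_numE//; apply: le_lt_trans AC _; rewrite ltey.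
rewrite addeC -leeBrDr//; apply: ge_ereal_sup => _ [k kg <-].
have k0 : 0 <= sintegral mu k by exact: sintegral_ge0.
have kfin : sintegral mu k \is a fin_num.
  rewrite ge0_fin_numE//; apply: le_lt_trans (_ : _ <= C) _; last by rewrite ltey.
  by have := key nnsfun0 k (h00 _ f0) kg; rewrite sintegral0 add0e.
rewrite leeBrDr// addeC -leeBrDr//; apply: ge_ereal_sup => _ [h hf <-].
by rewrite leeBrDr//; exact: key.
Qed.

End LowerIntegral.

Section LebesgueRV.
Context {R : realType}.
Notation mu := (@lebesgue_measure R).
Local Open Scope ereal_scope.

Lemma lebesgue_rV_ge0 d (A : set 'rV[R]_d) : 0 <= lebesgue_rV A.
Proof.
elim: d A => [|d IH] A /=; first by rewrite lee_fin.
by apply: integral_ge0 => t _; exact: IH.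
Qed.

Lemma lebesgue_rV0 d : lebesgue_rV (set0 : set 'rV[R]_d) = 0.
Proof.
elim: d => [|d IH] /=; first by rewrite indic0.
by apply: integral0_eq => t _; exact: IH.
Qed.

Lemma le_lebesgue_rV d (A B : set 'rV[R]_d) :
  A `<=` B -> lebesgue_rV A <= lebesgue_rV B.
Proof.
elim: d A B => [|d IH] A B AB /=.
  rewrite lee_fin !indicE; case: (boolP (0 \in A)%R) => //.
  by rewrite inE => /AB; rewrite -in_setE => ->.
apply: le_lower_integral => t; first exact: lebesgue_rV_ge0.
by apply: IH => y; exact: AB.
Qed.

Lemma lebesgue_rV_superadditive d (A B : set 'rV[R]_d) :
  A `&` B = set0 -> lebesgue_rV A + lebesgue_rV B <= lebesgue_rV (A `|` B).
Proof.
elim: d A B => [|d IH] A B AB /=.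
  rewrite -EFinD lee_fin !indicE.
  have nAB : ~ (A 0%R /\ B 0%R) by move=> ABz; rewrite -[False]/((set0 : set 'rV[R]_0) 0%R) -AB.
  rewrite in_setU; case: (boolP (0 \in A)%R) => a; case: (boolP (0 \in B)%R) => b /=.
  - by exfalso; apply: nAB; rewrite !inE in a b.
  - by rewrite addr0.
  - by rewrite add0r.
  - by rewrite addr0.
apply: le_trans (lower_integral_superadditive _ _) _ => [t|t|].
- exact: lebesgue_rV_ge0.
- exact: lebesgue_rV_ge0.
apply: le_lower_integral => t.
  by apply: adde_ge0; exact: lebesgue_rV_ge0.
apply: IH; rewrite -subset0 => y [Ay By].
suff: (set0 : set 'rV[R]_d.+1) (row_mx (t%:M : 'rV_1) y) by [].
by rewrite -AB.
Qed.

End LebesgueRV.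

Section Box.
Context {R : realType}.
Notation mu := (@lebesgue_measure R).

Definition box d (c : 'rV[R]_d) (r : R) : set 'rV[R]_d :=
  [set z | forall i, `|z 0 i - c 0 i| < r].

Lemma lebesgue_rV_box d (c : 'rV[R]_d) (r : R) : 0 < r ->
  lebesgue_rV (box c r) = ((r *+ 2) ^+ d)%:E.
Proof.
move=> r0; elim: d c => [|d IH] c /=.
  by rewrite indicE mem_set// => -[].
pose c' : 'rV[R]_(1 + d) := c.
have sec (t : R) : [set y : 'rV[R]_d | box c r (row_mx (t%:M : 'rV_1) y)] =
    if `|t - c 0 0| < r then box (rsubmx c') r else set0.
  have c0 : c 0 0 = c' 0 (lshift d (ord0 : 'I_1)).
    by congr (c _ _); exact: val_inj.
  pose z y : 'rV[R]_(1 + d) := row_mx (t%:M : 'rV_1) y.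
  have z0 y : z y 0 (lshift d (ord0 : 'I_1)) = t.
    by rewrite /z row_mxEl mxE eqxx mulr1n.
  have zr y j : z y 0 (rshift 1 j) = y 0 j by rewrite /z row_mxEr.
  apply/seteqP; split => y.
    move=> yb; have -> : `|t - c 0 0| < r by rewrite c0 -(z0 y); exact: yb.
    by move=> j; rewrite [rsubmx _ _ _]mxE -zr; exact: (yb (rshift 1 j)).
  case: ifP => // tr yb i.
  suff : `|z y 0 i - c' 0 i| < r by [].
  case: (split_ordP (i : 'I_(1 + d))) => j ->.
    by rewrite (ord1 j) z0 -c0.
  by rewrite zr; have := yb j; rewrite !mxE.
pose D : set R := `]c 0 0 - r, c 0 0 + r[%classic.
transitivity (\int[mu]_(t in D) cst ((r *+ 2) ^+ d)%:E t)%E.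
  rewrite [RHS]integral_mkcond; apply: eq_integral => t _.
  rewrite sec patchE /D mem_setE in_itv /= ltr_distl.
  by case: ifP => _; [exact: IH | exact: lebesgue_rV0].
rewrite /D integral_cst//= lebesgue_measure_itv /= lte_fin.
rewrite ltrD2l gtrN// -EFinB -EFinM exprSr; congr (_ * _)%:E.
by rewrite opprD opprK addrACA subrr add0r -mulr2n.
Qed.

End Box.

(** * The Euclidean structure of the space of row vectors *)

Section SupNorm.
Context {R : realType}.

Lemma coord_le_norm p q (A : 'M[R]_(p, q)) i j : `|A i j| <= `|A|.
Proof.
rewrite [leRHS]/Num.Def.normr /= mx_normrE.
by apply/bigmax_geP; right => /=; exists (i, j).
Qed.

Lemma norm_le_coord p q (A : 'M[R]_(p, q)) r : 0 <= r ->
  (forall i j, `|A i j| <= r) -> `|A| <= r.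
Proof.
move=> r0 Ar; rewrite [leLHS]/Num.Def.normr /= mx_normrE.
by apply: bigmax_le => // -[i j] _ /=.
Qed.

End SupNorm.

Section Dot.
Context {R : realType} {N : nat}.
Implicit Types x y z : 'rV[R]_N.

Lemma dotE x y : dot x y = \sum_i x 0 i * y 0 i.
Proof. by rewrite /dot mxE; apply: eq_bigr => i _; rewrite mxE. Qed.

Lemma dotC x y : dot x y = dot y x.
Proof. by rewrite !dotE; apply: eq_bigr => i _; rewrite mulrC. Qed.

Lemma dotDl x y z : dot (x + y) z = dot x z + dot y z.
Proof. by rewrite /dot mulmxDl mxE. Qed.

Lemma dotZl a x z : dot (a *: x) z = a * dot x z.
Proof. by rewrite /dot -scalemxAl mxE. Qed.

Lemma dotNl x z : dot (- x) z = - dot x z.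
Proof. by rewrite -scaleN1r dotZl mulN1r. Qed.

Lemma dotBl x y z : dot (x - y) z = dot x z - dot y z.
Proof. by rewrite dotDl dotNl. Qed.

Lemma dot0l z : dot 0 z = 0.
Proof. by rewrite -(scale0r z) dotZl mul0r. Qed.

Lemma dot_suml (I : finType) (P : pred I) (F : I -> 'rV[R]_N) z :
  dot (\sum_(i | P i) F i) z = \sum_(i | P i) dot (F i) z.
Proof. by rewrite /dot mulmx_suml summxE. Qed.

Lemma dotDr x y z : dot z (x + y) = dot z x + dot z y.
Proof. by rewrite dotC dotDl !(dotC z). Qed.

Lemma dotZr a x z : dot z (a *: x) = a * dot z x.
Proof. by rewrite dotC dotZl (dotC z). Qed.

Lemma dotNr x z : dot z (- x) = - dot z x.
Proof. by rewrite dotC dotNl (dotC z). Qed.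

Lemma dotBr x y z : dot z (x - y) = dot z x - dot z y.
Proof. by rewrite dotDr dotNr. Qed.

Lemma dot0r z : dot z 0 = 0.
Proof. by rewrite dotC dot0l. Qed.

Lemma dot_sumr (I : finType) (P : pred I) (F : I -> 'rV[R]_N) z :
  dot z (\sum_(i | P i) F i) = \sum_(i | P i) dot z (F i).
Proof. by rewrite dotC dot_suml; apply: eq_bigr => i _; rewrite dotC. Qed.

Lemma dot_ge0 x : 0 <= dot x x.
Proof. by rewrite dotE; apply: sumr_ge0 => i _; rewrite -expr2 sqr_ge0. Qed.

Lemma dot_eq0 x : (dot x x == 0) = (x == 0).
Proof.
apply/eqP/eqP => [|->]; last by rewrite dot0l.
rewrite dotE => /eqP; rewrite psumr_eq0; last first.
  by move=> i _; rewrite -expr2 sqr_ge0.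
move=> /allP x0; apply/rowP => i; rewrite mxE; apply/eqP.
by have := x0 i (mem_index_enum i); rewrite -expr2 sqrf_eq0.
Qed.

Lemma dot_gt0 x : (0 < dot x x) = (x != 0).
Proof. by rewrite lt_def dot_ge0 andbT dot_eq0. Qed.

Lemma sphere_neq0 x : sphere x -> x != 0.
Proof. by move=> xs; rewrite -dot_eq0 [dot x x]xs oner_eq0. Qed.

Lemma sphereN x : sphere x -> sphere (- x).
Proof. by move=> xs; rewrite /sphere /= dotNl dotNr opprK. Qed.

Lemma dot_sphere_le1 x y : sphere x -> sphere y -> dot x y <= 1.
Proof.
move=> xs ys; have := dot_ge0 (x - y).
rewrite dotBl !dotBr (dotC y x) [dot x x]xs [dot y y]ys; lra.
Qed.

Lemma dot_sphere_eq1 x y : sphere x -> sphere y -> dot x y = 1 -> x = y.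
Proof.
move=> xs ys xy1; apply/eqP; rewrite -subr_eq0 -dot_eq0.
by rewrite dotBl !dotBr (dotC y x) [dot x x]xs [dot y y]ys xy1; apply/eqP; lra.
Qed.

Lemma sphere_norm_le1 x : sphere x -> `|x| <= 1.
Proof.
move=> xs; apply: norm_le_coord => // k i; rewrite (ord1 k).
rewrite -[leRHS]ger0_norm// -ler_sqr ?nnegrE// !real_normK ?num_real//.
rewrite expr1n -[leRHS]xs dotE (bigD1 i)//= expr2 lerDl.
by apply: sumr_ge0 => j _; rewrite -expr2 sqr_ge0.
Qed.

Lemma dot_le_norm x y : `|dot x y| <= N%:R * (`|x| * `|y|).
Proof.
rewrite dotE; apply: le_trans (ler_norm_sum _ _ _) _.
apply: (@le_trans _ _ (\sum_(i < N) `|x| * `|y|)).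
  by apply: ler_sum => i _; rewrite normrM ler_pM ?coord_le_norm.
by rewrite sumr_const card_ord -[leLHS]mulr_natl.
Qed.

End Dot.

Section Convergence.
Context {R : realType} {T : Type} {F : set_system T} {FF : Filter F}.

Lemma cvg_sum (V : normedModType R) (I : finType) (P : pred I)
    (f : I -> T -> V) (a : I -> V) :
  (forall i, P i -> f i x @[x --> F] --> a i) ->
  \sum_(i | P i) f i x @[x --> F] --> \sum_(i | P i) a i.
Proof. by move=> fa; apply: cvg_big => //; exact: add_continuous. Qed.

Lemma cvg_coord N (f : T -> 'rV[R]_N) (a : 'rV[R]_N) i :
  f x @[x --> F] --> a -> f x 0 i @[x --> F] --> a 0 i.
Proof.
move=> fa.
exact: (@cvg_comp _ _ _ f (fun x : 'rV[R]_N => x 0 i) _ _ _ fa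
  (@coord_continuous R 1 N 0 i a)).
Qed.

Lemma cvg_dot N (f g : T -> 'rV[R]_N) (a b : 'rV[R]_N) :
  f x @[x --> F] --> a -> g x @[x --> F] --> b ->
  dot (f x) (g x) @[x --> F] --> dot a b.
Proof.
move=> fa gb; rewrite dotE; under eq_fun do rewrite dotE.
by apply: (@cvg_sum R^o) => i _; apply: cvgM; exact: cvg_coord.
Qed.

End Convergence.

(** * Comparison of two caps of the sphere *)

Section Caps.
Context {R : realType} {n : nat}.
Implicit Types (m y : 'rV[R]_n.+1).

Lemma le_sphere_volume (A B : set 'rV[R]_n.+1) :
  A `<=` B -> (sphere_volume A <= sphere_volume B)%E.
Proof.
move=> AB; apply: lee_wpmul2l => //.
by apply: le_lebesgue_rV => z [t [x [t0 t1 /AB Bx ->]]]; exists t, x.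
Qed.

(** The cone over the smaller cap misses a small box inside the cone over the
    intermediate zone, and such a box has positive measure. *)
Lemma sphere_volume_lt_caps m e (a b : R) : sphere m -> sphere e ->
  dot e m = 0 -> 0 < a -> a < b -> b <= 1 ->
  forall A B : set 'rV[R]_n.+1,
  A `<=` [set y | sphere y /\ b <= dot y m] ->
  [set y | sphere y /\ a < dot y m] `<=` B ->
  (sphere_volume A < sphere_volume B)%E.
Proof.
move=> ms es em a0 ab b1 A B Ab aB.
pose Z c := [set y : 'rV[R]_n.+1 | sphere y /\ c <= dot y m].
apply: (@le_lt_trans _ _ (sphere_volume (Z b))); first exact: le_sphere_volume.
pose Y := [set y : 'rV[R]_n.+1 | sphere y /\ a < dot y m].
apply: (@lt_le_trans _ _ (sphere_volume Y)); last exact: le_sphere_volume.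
rewrite /sphere_volume lte_pmul2l ?lte_fin//.
(* the centre of the box: a point of height c strictly between a and b,
   scaled into the interior of the ball *)
pose c := (a + b) / 2.
have [ac cb] : a < c /\ c < b by rewrite /c; split; lra.
pose y0 : 'rV[R]_n.+1 := c *: m + Num.sqrt (1 - c ^+ 2) *: e.
pose z0 : 'rV[R]_n.+1 := 2^-1 *: y0.
have y0m : dot y0 m = c by rewrite dotDl !dotZl em [dot m m]ms; lra.
have c2 : 0 <= 1 - c ^+ 2 by nra.
have y0s : sphere y0.
  rewrite /sphere /= dotDl !dotDr !dotZl !dotZr em (dotC m e) em.
  rewrite [dot m m]ms [dot e e]es !mulr0 addr0 add0r !mulr1 -!expr2.
  by rewrite sqr_sqrtr//; lra.
pose U := [set z : 'rV[R]_n.+1 | [/\ 0 < dot z m, dot z z < 1,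
  a ^+ 2 * dot z z < dot z m ^+ 2 & dot z m ^+ 2 < b ^+ 2 * dot z z]].
have zz : dot z0 z0 = 4^-1.
  by rewrite dotZl dotZr [dot y0 y0]y0s mulr1; lra.
have zm : dot z0 m = c / 2 by rewrite dotZl y0m mulrC.
have [r r0 boxU] : exists2 r : R, 0 < r & box z0 r `<=` U.
  have cm : dot z m @[z --> z0] --> dot z0 m.
    by apply: (cvg_dot (F := nbhs z0) (f := id) (g := cst m)); [exact: cvg_id|exact: cvg_cst].
  have cz : dot z z @[z --> z0] --> dot z0 z0
    by apply: (cvg_dot (F := nbhs z0) (f := id) (g := id)); exact: cvg_id.
  have cm2 : dot z m ^+ 2 @[z --> z0] --> dot z0 m ^+ 2 by exact: (cvgM cm cm).
  have opn (f : 'rV[R]_n.+1 -> R) (l : R) : f z @[z --> z0] --> l -> 0 < l ->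
      \forall z \near z0, 0 < f z.
    by move=> fl l0; exact: (cvgr_gt l fl).
  have n1 := opn _ _ cm _.
  have n2 := opn _ _ (cvgB (cvg_cst (1 : R)) cz) _.
  have n3 := opn _ _ (cvgB cm2 (cvgM (cvg_cst (a ^+ 2 : R)) cz)) _.
  have n4 := opn _ _ (cvgB (cvgM (cvg_cst (b ^+ 2 : R)) cz) cm2) _.
  have : nbhs z0 U.
    near=> z; split.
    - by near: z; apply: n1; rewrite zm; lra.
    - by rewrite -subr_gt0; near: z; apply: n2; rewrite zz; lra.
    - by rewrite -subr_gt0; near: z; apply: n3; rewrite zz zm; nra.
    - by rewrite -subr_gt0; near: z; apply: n4; rewrite zz zm; nra.
  move=> /nbhs_ballP [r /= r0 rU]; exists r => // z zr; apply: rU.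
  by split => // i j; rewrite (ord1 i) /ball /= distrC; exact: zr.
have UY : U `<=` cone Y `\` cone (Z b).
  move=> z [zm0 z1 az bz].
  have z00 : 0 < dot z z by rewrite dot_gt0; apply: contraTN zm0 => /eqP ->; rewrite dot0l ltxx.
  pose t := Num.sqrt (dot z z).
  have t0 : 0 < t by rewrite sqrtr_gt0.
  have tt : t ^+ 2 = dot z z by rewrite sqr_sqrtr// ltW.
  split.
    exists t, (t^-1 *: z); split => //.
    - by rewrite -(expr_le1 (_ : 0 < 2)%N)// ?tt; exact: ltW.
    - split.
        by rewrite /sphere /= dotZl dotZr -tt expr2 mulKf ?gt_eqF// mulVf ?gt_eqF.
      rewrite dotZl ltr_pdivlMl//.
      rewrite -ltr_sqr ?nnegrE; [|nra|exact: ltW].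
      by rewrite exprMn tt mulrC.
    - by rewrite scalerA mulfV ?gt_eqF// scale1r.
  move=> [s [x [s0 s1 [xs xb] zE]]]; move: bz.
  rewrite zE !dotZl !dotZr [dot x x]xs mulr1 exprMn.
  by apply/negP; rewrite -leNgt -expr2 [leLHS]mulrC ler_wpM2l ?sqr_ge0// ler_sqr ?nnegrE; lra.
have ZYb : cone (Z b) `|` box z0 r `<=` cone Y.
  move=> z [|/boxU/UY []//] [t [x [t0 t1 [xs xb] zE]]].
  by exists t, x; split => //; split => //; exact: lt_le_trans xb.
apply: lt_le_trans (le_lebesgue_rV ZYb).
apply: lt_le_trans (lebesgue_rV_superadditive _); last first.
  by rewrite -subset0 => z [zb /boxU/UY [_]]; exact.
rewrite lebesgue_rV_box// -[ltLHS]adde0 lteD2lE ?lte_fin ?exprn_gt0 ?mulrn_wgt0//.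
rewrite ge0_fin_numE ?lebesgue_rV_ge0//.
apply: (@le_lt_trans _ _ (lebesgue_rV (box (0 : 'rV[R]_n.+1) 2))).
  apply: le_lebesgue_rV => z [t [x [t0 t1 [xs xb] ->]]] i.
  rewrite !mxE subr0 normrM gtr0_norm//.
  apply: (@le_lt_trans _ _ 1); last lra.
  rewrite -[leRHS]mulr1 ler_pM ?(ltW t0)//.
  exact: le_trans (coord_le_norm _ _ _) (sphere_norm_le1 xs).
by rewrite lebesgue_rV_box// ltry.
Unshelve. all: by end_near. Qed.

End Caps.

(** * The parts of the sphere cut off by a polyhedron *)

Section Parts.
Context {R : realType} {n : nat}.
Implicit Types (m y : 'rV[R]_n.+1) (P : 'M[R]_(2, n) -> 'rV[R]_n.+1).

(** The connecting set is the piece of the meridian through [y], parametrized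
    by the height. *)
Lemma cap_meridian m y t : sphere m -> sphere y -> t <= 1 -> dot y m < t ->
  exists B : set 'rV[R]_n.+1, [/\ connected B, B (- m), B y &
    B `<=` [set z | sphere z /\ dot z m < t]].
Proof.
move=> ms ys t1 yt; pose h := dot y m.
have h1 : h < 1 by exact: lt_le_trans t1.
have hN1 : -1 <= h.
  have := dot_sphere_le1 ys (sphereN ms); rewrite dotNr -/h; lra.
have [hE|hne] := eqVneq h (-1).
  have -> : y = - m.
    by apply: dot_sphere_eq1 => //; [exact: sphereN|rewrite dotNr -/h hE opprK].
  exists [set - m]; split => //; first exact: connected1.
  move=> _ ->; split; first exact: sphereN.
  by rewrite dotNl [dot m m]ms -hE.
have hN1' : -1 < h by rewrite lt_neqAle eq_sym hne.
have k2 : 0 < 1 - h ^+ 2 by nra.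
pose k := Num.sqrt (1 - h ^+ 2).
have k0 : 0 < k by rewrite sqrtr_gt0.
have kk : k * k = 1 - h ^+ 2 by rewrite -expr2 sqr_sqrtr// ltW.
pose e := k^-1 *: (y - h *: m).
have em : dot e m = 0 by rewrite dotZl dotBl dotZl [dot m m]ms -/h mulr1 subrr mulr0.
have ee : dot e e = 1.
  rewrite dotZl dotZr dotBl !dotBr !dotZl !dotZr (dotC m y) -/h.
  rewrite [dot m m]ms [dot y y]ys.
  have -> : 1 - h * h - (h * h - h * (h * 1)) = k * k by rewrite kk; ring.
  by rewrite mulKf ?gt_eqF// mulVf ?gt_eqF.
pose f (s : R) : 'rV[R]_n.+1 := s *: m + Num.sqrt (1 - s ^+ 2) *: e.
have fh : f h = y.
  by rewrite /f -/k scalerA mulfV ?gt_eqF// scale1r addrC subrK.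
clearbody e.
have fN1 : f (-1) = - m.
  by rewrite /f sqrrN expr1n subrr sqrtr0 scale0r addr0 scaleN1r.
exists (f @` `[-1, h]); split.
- apply: connected_continuous_connected; first exact: segment_connected.
  apply: continuous_subspaceT => s; rewrite /continuous_at.
  have c2 : (1 : R) - x ^+ 2 @[x --> s] --> 1 - s ^+ 2.
    apply: cvgB; first exact: cvg_cst.
    exact: (cvgM (f := id) (g := id) cvg_id cvg_id).
  have c3 : Num.sqrt (1 - x ^+ 2) @[x --> s] --> Num.sqrt (1 - s ^+ 2).
    exact: (cvg_comp _ _ c2 (@sqrt_continuous R (1 - s ^+ 2))).
  have c1 : x *: m @[x --> s] --> s *: m.
    exact: (@cvgZr_tmp _ _ _ (nbhs s) _ id s m cvg_id).
  exact: (cvgD c1 (cvgZr_tmp (a := e) c3)).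
- by exists (-1) => //=; rewrite in_itv /= lexx.
- by exists h => //=; rewrite in_itv /= lexx andbT.
- move=> _ [s + <-] => /=; rewrite in_itv /= => /andP[s1 sh].
  have s2 : 0 <= 1 - s ^+ 2 by nra.
  split.
    rewrite /sphere /f /= dotDl !dotDr !dotZl !dotZr em (dotC m e) em ee.
    rewrite [dot m m]ms !mulr0 addr0 add0r !mulr1 -!expr2 sqr_sqrtr//; ring.
  rewrite /f dotDl !dotZl em [dot m m]ms mulr0 addr0 mulr1.
  exact: le_lt_trans yt.
Qed.

(** Formulated with connected sets avoiding [S], so that the components of
    the complement need not be described. *)
Definition separates_poles m (S : set 'rV[R]_n.+1) :=
  forall B : set 'rV[R]_n.+1, connected B -> B `<=` sphere `\` S ->
    B m -> ~ B (- m).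

Section Polyhedron.
Variables (m : 'rV[R]_n.+1) (P : 'M[R]_(2, n) -> 'rV[R]_n.+1).
Hypothesis ms : sphere m.

Lemma far_part_sub b : b <= 1 ->
  surface P `<=` [set y | b <= dot y m] ->
  far_part m P `<=` [set y | sphere y /\ b <= dot y m].
Proof.
move=> b1 Sb y [[ys nSy] ncomp]; split => //; rewrite leNgt; apply/negP => yb.
have [B [Bc BN By Bs]] := cap_meridian ms ys b1 yb.
apply: ncomp; exists B => //; split => // z /Bs [zs zb]; split => // /Sb /=.
by rewrite leNgt zb.
Qed.

Hypothesis sep : separates_poles m (surface P).

Lemma pole_part_sub b : b <= 1 ->
  surface P `<=` [set y | b <= dot y m] ->
  pole_part m P `<=` [set y | sphere y /\ b <= dot y m].
Proof.
move=> b1 Sb; rewrite /pole_part; case: ifP => _; first exact: far_part_sub.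
move=> y ym; have [ys _] := connected_component_sub ym.
split => //; rewrite leNgt; apply/negP => yb.
have [B [Bc BN By Bs]] := cap_meridian ms ys b1 yb.
have Bo : B `<=` off_surface P.
  by move=> z /Bs [zs zb]; split => // /Sb /=; rewrite leNgt zb.
have [A [Am Ao Ac] Ay] := ym.
apply: (sep (B := A `|` B)).
- by apply: connectedU => //; exists y.
- by move=> z []; [exact: Ao|exact: Bo].
- by left.
- by right.
Qed.

Lemma upper_cap_connected a y : -1 <= a -> a < dot y m -> sphere y ->
  surface P `<=` [set y | dot y m <= a] ->
  connected_component (off_surface P) m y.
Proof.
move=> a1 ay ys Sa.
have a1' : - a <= 1 by lra.
have ya : dot y (- m) < - a by rewrite dotNr ltrN2.
have [B [Bc Bm By Bs]] := cap_meridian (sphereN ms) ys a1' ya.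
rewrite opprK in Bm; exists B => //; split => // z /Bs [zs].
by rewrite dotNr ltrN2 => az; split => // /Sa /=; rewrite leNgt az.
Qed.

Lemma far_part_sup a : -1 <= a -> surface P `<=` [set y | dot y m <= a] ->
  [set y | sphere y /\ a < dot y m] `<=` far_part m P.
Proof.
move=> a1 Sa y [ys ay]; have ym := upper_cap_connected a1 ay ys Sa.
split; first exact: connected_component_sub ym.
move=> yN; have mN : connected_component (off_surface P) m (- m).
  apply: connected_component_trans ym _; exact: connected_component_sym.
have [B [Bm Bo Bc] BN] := mN.
exact: (sep Bc Bo Bm BN).
Qed.

Lemma pole_part_sup a : -1 <= a -> surface P `<=` [set y | dot y m <= a] ->
  [set y | sphere y /\ a < dot y m] `<=` pole_part m P.
Proof.
move=> a1 Sa; rewrite /pole_part; case: ifP => _; first exact: far_part_sup.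
by move=> y [ys ay]; exact: upper_cap_connected ay ys Sa.
Qed.

End Polyhedron.
End Parts.

(** * Small perturbations of a complete simplicial fan *)

(** Joins the completeness of matrix spaces with their norm, so that the
    contraction principle applies to them. *)
HB.instance Definition _ (R : realType) (p q : nat) :=
  Uniform_isComplete.Build 'M[R]_(p, q) (@cauchy_cvg _).

Lemma lipschitz_is_continuous (R : realType) (U W : normedModType R)
    (f : U -> W) (k : R) :
  (forall x y, `|f x - f y| <= k * `|x - y|) -> continuous f.
Proof.
move=> fk x; apply/cvgrPdist_le => e e0.
have k0 : 0 < `|k| + 1 by rewrite ltr_wpDl.
have r0 : 0 < e / (`|k| + 1) by rewrite divr_gt0.
near=> y; apply: le_trans (fk _ _) _.
have xy : `|x - y| <= e / (`|k| + 1).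
  by near: y; apply: (@cvgr_dist_le _ U _ (nbhs x) _ id x _ _ r0); exact: cvg_id.
apply: (@le_trans _ _ ((`|k| + 1) * `|x - y|)).
  by apply: ler_wpM2r => //; apply: le_trans (ler_norm _) _; rewrite lerDl.
by rewrite mulrC -ler_pdivlMr.
Unshelve. all: by end_near. Qed.

Section LipschitzPerturbation.
Context {R : realType} {n : nat}.
Notation V := 'rV[R]_n.+1.

(** The equation [z + G z = y] is a fixed point problem for the contraction
    [z |-> y - G z]. *)
Lemma lipschitz_perturbation_inverse (G : V -> V) :
  (forall x y, `|G x - G y| <= 2^-1 * `|x - y|) ->
  exists E : V -> V, [/\ forall y, E y + G (E y) = y,
    forall x, E (x + G x) = x &
    forall x y, `|E x - E y| <= 2 * `|x - y|].
Proof.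
move=> GL.
have fixed (y : V) : exists z, z + G z = y.
  pose f : {fun [set: V] >-> [set: V]} := totalfun_ [set: V] (fun z : V => y - G z).
  have ctr : is_contraction f.
    exists (2^-1)%:nng; split; first by rewrite /=; lra.
    move=> [a b] _ /=; rewrite /f /totalfun_ opprB addrC addrA subrK.
    by rewrite distrC; exact: GL.
  have [z _ zE] := @banach_fixed_point R V setT f ctr closedT (ex_intro _ 0 I).
  by exists z; rewrite {1}zE /f /totalfun_ subrK.
have [E EP] := choice fixed.
have expand x y : `|x - y| <= 2 * `|(x + G x) - (y + G y)|.
  have -> : (x + G x) - (y + G y) = (x - y) - (G y - G x).
    by rewrite opprB opprD addrACA.
  have := lerB_dist (x - y) (G y - G x); have := GL y x.
  by rewrite (distrC y x); lra.
exists E; split => // [x|x y].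
  apply/eqP; rewrite -subr_eq0 -normr_le0.
  by apply: le_trans (expand _ _) _; rewrite EP subrr normr0 mulr0.
by rewrite -{2}(EP x) -{2}(EP y); exact: expand.
Qed.

End LipschitzPerturbation.

Section Fan.
Context {R : realType} {n : nat}.
Notation V := 'rV[R]_n.+1.
Notation coefs := 'M[R]_(2, n).
Notation vertex := (@vertex n).
Implicit Types (c d : coefs) (p w : vertex -> V).

Definition comb p c : V := \sum_(v : vertex) c v.1 v.2 *: p v.

(** The cone over the realization of the complex. *)
Definition admissible c :=
  (forall e i, 0 <= c e i) /\ (forall i, c 0 i = 0 \/ c 1 i = 0).

(** The simplicial cones spanned by the vectors [w v] form a complete fan in
    the hyperplane orthogonal to [m]; a vector is decomposed in this fan by the
    map [coef], which is required to be Lipschitz. *)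
Record fan_coordinates (m : V) w (coef : V -> coefs) (K : R) : Prop := {
  fan_admissible : forall x, admissible (coef x);
  fan_comb : forall x, x = comb w (coef x) + dot x m *: m;
  fan_coefK : forall c h, admissible c -> coef (comb w c + h *: m) = c;
  fan_orth : forall v, dot (w v) m = 0;
  fan_lip_ge0 : 0 <= K;
  fan_lip : forall x y e i, `|coef x e i - coef y e i| <= K * `|x - y| }.

Lemma comb0 p : comb p 0 = 0.
Proof. by rewrite /comb big1// => v _; rewrite mxE scale0r. Qed.

Lemma combZ p a c : comb p (a *: c) = a *: comb p c.
Proof.
by rewrite /comb scaler_sumr; apply: eq_bigr => v _; rewrite mxE scalerA.
Qed.

Lemma admissible0 : admissible 0.
Proof. by split => [e i|i]; rewrite mxE; [|left]. Qed.

Lemma admissibleZ a c : 0 <= a -> admissible c -> admissible (a *: c).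
Proof.
move=> a0 [c0 cc]; split => [e i|i]; rewrite !mxE; first exact: mulr_ge0.
by case: (cc i) => ->; rewrite mulr0; [left|right].
Qed.

Lemma dot_comb p c x : dot (comb p c) x = \sum_(v : vertex) c v.1 v.2 * dot (p v) x.
Proof. by rewrite dot_suml; apply: eq_bigr => v _; rewrite dotZl. Qed.

Section Perturbation.
Variables (m : V) (w p : vertex -> V) (coef : V -> coefs) (K eps : R).
Hypothesis ms : sphere m.
Hypothesis fan : fan_coordinates m w coef K.
Hypothesis close : forall v, `|p v - w v| <= eps.
Hypothesis small : (n.*2)%:R * (K * eps) <= 2^-1.



Lemma card_vertex : #|{: vertex}| = n.*2.
Proof. by rewrite card_prod !card_ord mul2n. Qed.

Lemma fan_displacement_lip x y :
  `|(comb p (coef x) - comb w (coef x)) - (comb p (coef y) - comb w (coef y))|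
    <= 2^-1 * `|x - y|.
Proof.
rewrite /comb -!sumrB; apply: le_trans (ler_norm_sum _ _ _) _.
apply: (@le_trans _ _ (\sum_(v : vertex) K * eps * `|x - y|)).
  apply: ler_sum => v _; rewrite -!scalerBr -scalerBl normrZ.
  rewrite mulrAC; apply: ler_pM => //.
  exact: (fan_lip fan).
rewrite sumr_const card_vertex -[leLHS]mulr_natl mulrA.
exact: ler_wpM2r.
Qed.

(** The piecewise linear map sending the ray of [w v] to that of [p v] and
    fixing [m] differs from the identity by a contraction, so it is a
    bi-Lipschitz homeomorphism of the whole space. *)
Lemma perturbed_fan : exists E : V -> V,
  [/\ forall y, y = comb p (coef (E y)) + dot (E y) m *: m,
      forall c h, admissible c -> E (comb p c + h *: m) = comb w c + h *: m &
      forall x y, `|E x - E y| <= 2 * `|x - y|].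
Proof.
have [E [E1 E2 E3]] := lipschitz_perturbation_inverse fan_displacement_lip.
exists E; split => // [y|c h ca].
  by rewrite -[LHS](E1 y) {1}(fan_comb fan (E y)) addrC addrA subrK.
have := E2 (comb w c + h *: m); rewrite (fan_coefK fan h ca).
by rewrite [X in E X]addrC addrA subrK.
Qed.

Lemma fan_coef_comb c : admissible c -> coef (comb w c) = c.
Proof. by move=> ca; rewrite -[comb w c]addr0 -(scale0r m) (fan_coefK fan). Qed.

Lemma perturbed_comb_inj c d : admissible c -> admissible d ->
  comb p c = comb p d -> c = d.
Proof.
move=> ca da cd; have [E [_ E2 _]] := perturbed_fan.
rewrite -(fan_coef_comb ca) -(fan_coef_comb da); congr coef.
have := E2 c 0 ca; have := E2 d 0 da; rewrite !scale0r !addr0 cd => ->.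
by [].
Qed.

(** Provides the continuous inverse of the parametrization of a polyhedron
    whose vertices span the perturbed fan. *)
Lemma perturbed_coef : exists D : V -> coefs,
  [/\ continuous D, forall y, admissible (D y) &
      forall c, admissible c -> D (comb p c) = c].
Proof.
have [E [E1 E2 E3]] := perturbed_fan.
exists (coef \o E); split => [|y|c ca] /=.
- apply: (@lipschitz_is_continuous _ _ _ _ (K * 2)) => x y.
  rewrite [leLHS]/Num.Def.normr /= mx_normrE; apply: bigmax_le => [|[e i] _ /=].
    by rewrite !mulr_ge0 ?(fan_lip_ge0 fan).
  rewrite !mxE; apply: le_trans (fan_lip fan _ _ _ _) _.
  rewrite -mulrA; apply: ler_wpM2l; [exact: fan_lip_ge0 fan|exact: E3].
- exact: fan_admissible fan _.
- by have := E2 c 0 ca; rewrite !scale0r !addr0 => ->; exact: fan_coef_comb.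
Qed.

(** The height of the preimage of a point under the homeomorphism of
    [perturbed_fan] is a continuous function, positive at [m] and negative at
    [- m], which vanishes only on the cones of the perturbed fan. *)
Lemma perturbed_fan_separates (S : set V) :
  (forall c, admissible c -> sphere (comb p c) -> S (comb p c)) ->
  separates_poles m S.
Proof.
move=> cS; have [E [E1 E2 E3]] := perturbed_fan.
have Em h : E (h *: m) = h *: m.
  by have := E2 0 h admissible0; rewrite !comb0 !add0r.
pose D y := dot (E y) m.
have Dc : continuous D.
  apply: (@lipschitz_is_continuous _ _ _ _ (n.+1%:R * `|m| * 2)) => x y.
  rewrite /D -dotBl; apply: le_trans (dot_le_norm _ _) _.
  rewrite -!mulrA; apply: ler_wpM2l => //.
  by rewrite mulrC; apply: ler_wpM2l.
move=> B Bc BS Bm BN.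
have : connected (D @` B).
  by apply: connected_continuous_connected => //; exact: continuous_subspaceT.
move=> /connected_intervalP DB.
have [y By Dy0] : (D @` B) 0.
  apply: (DB (-1) 1).
  - by exists (- m) => //; rewrite /D -scaleN1r Em dotZl [dot m m]ms mulr1.
  - by exists m => //; rewrite /D -[m]scale1r Em dotZl scale1r [dot m m]ms mulr1.
  - by rewrite lerN10 ler01.
have [ys nSy] := BS y By.
have yE : y = comb p (coef (E y)).
  by rewrite [LHS]E1 -/(D y) Dy0 scale0r addr0.
apply: nSy; rewrite yE; apply: cS; last by rewrite -yE.
exact: fan_admissible fan _.
Qed.

(** The coordinates of a point of the sphere are at most [2 * K], because the
    inverse homeomorphism is 2-Lipschitz and fixes the origin. *)
Lemma perturbed_height c eta : admissible c -> sphere (comb p c) ->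
  (forall v, `|dot (p v) m| <= eta) ->
  `|dot (comb p c) m| <= (n.*2)%:R * (2 * K * eta).
Proof.
have K0 := fan_lip_ge0 fan.
move=> ca cs peta; have [E [_ E2 E3]] := perturbed_fan.
have E0 : E 0 = 0.
  by have := E2 0 0 admissible0; rewrite !comb0 scale0r !addr0.
have Ec : E (comb p c) = comb w c.
  by have := E2 c 0 ca; rewrite scale0r !addr0.
have wc2 : `|comb w c| <= 2.
  have := E3 (comb p c) 0; rewrite E0 Ec !subr0.
  by have := sphere_norm_le1 cs; lra.
have c_le e i : `|c e i| <= 2 * K.
  have := fan_lip fan (comb w c) (comb w 0) e i.
  rewrite (fan_coef_comb ca) (fan_coef_comb admissible0) mxE !subr0 comb0 subr0.
  by move=> /le_trans; apply; rewrite mulrC ler_wpM2r.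
rewrite dot_comb; apply: le_trans (ler_norm_sum _ _ _) _.
apply: (@le_trans _ _ (\sum_(v : vertex) 2 * K * eta)).
  by apply: ler_sum => v _; rewrite normrM; apply: ler_pM.
by rewrite sumr_const card_vertex -[leLHS]mulr_natl.
Qed.

End Perturbation.
End Fan.

(** * Piecewise Lipschitz functions *)

Section Piecewise.
Context {R : realType}.

(** Induction on the number of pieces: the piece containing [a] is followed
    up to its last point [z] in the interval, and the rest of the interval is
    covered by the other pieces, because their union is closed. *)
Lemma piecewise_lipschitz_itv (I : finType) (J : I -> set R) (f : R -> R) (k : R) :
  (forall i, closed (J i)) ->
  (forall i t u, J i t -> J i u -> `|f t - f u| <= k * `|t - u|) ->
  forall (S : {set I}) (a b : R), a <= b ->
  (forall t, a <= t <= b -> exists2 i, i \in S & J i t) ->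
  `|f b - f a| <= k * (b - a).
Proof.
move=> Jcl Jf S; elim: {S}_.+1 {-2}S (ltnSn #|S|) => // N IH S SN a b ab cov.
have [i iS Jia] := cov a (introT andP (conj (lexx a) ab)).
pose A := [set t | J i t /\ a <= t <= b].
have Aa : A a by split; rewrite // lexx ab.
have Aub : has_ubound A by exists b => t [_ /andP[]].
pose z := sup A.
have Az : A z.
  suff : closed A by move=> /closure_id ->; apply: closure_sup => //; exists a.
  have -> : A = J i `&` ([set t | a <= t] `&` [set t | t <= b]).
    apply/seteqP; split=> t [Jt]; first by move=> /andP[].
    by move=> /= -[at_ tb]; split=> //; rewrite at_.
  by apply: closedI => //; apply: closedI; [exact: closed_ge|exact: closed_le].
have [Jz /andP[az zb]] := Az.
have fz : `|f z - f a| <= k * (z - a).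
  by have := Jf i z a Jz Jia; rewrite (ger0_norm (x := z - a)) ?subr_ge0.
have [zbE|zb'] := eqVneq z b; first by rewrite -zbE.
have {}zb' : z < b by rewrite lt_neqAle zb'.
have rest t : z < t <= b -> exists2 j, j \in S :\ i & J j t.
  move=> /andP[zt tb]; have at_ : a <= t by rewrite (le_trans az)// ltW.
  have [j jS Jjt] := cov t (introT andP (conj at_ tb)).
  exists j => //; rewrite !inE jS andbT; apply/eqP => ji.
  suff : t <= z by rewrite leNgt zt.
  by apply: ub_le_sup => //; split; rewrite -?ji// at_.
pose U := \bigcup_(j in [set j | j \in S :\ i]) J j.
have Uz : U z.
  suff : closed U.
    move=> /closure_id ->; move=> B /nbhs_ballP[r /= r0 rB].
    pose t := Num.min b (z + r / 2).
    have zt : z < t by rewrite lt_min zb' ltrDl divr_gt0.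
    have tb : t <= b by rewrite ge_min lexx.
    have tr : t <= z + r / 2 by rewrite ge_min lexx orbT.
    have [j jS Jjt] := rest t (introT andP (conj zt tb)).
    exists t; split; first by exists j.
    by apply: rB; rewrite /ball /= ltr_distl; apply/andP; split; lra.
  by apply: closed_bigcup => //; exact: finite_finset.
have {}rest t : z <= t <= b -> exists2 j, j \in S :\ i & J j t.
  rewrite le_eqVlt => /andP[/orP[/eqP<- _|zt tb]]; first by case: Uz => j; exists j.
  by apply: rest; rewrite zt.
have : `|f b - f z| <= k * (b - z).
  apply: (IH (S :\ i)) => //; rewrite ltnS in SN.
  by move: SN; rewrite (cardsD1 i) iS add1n.
have := ler_distD (f z) (f b) (f a); lra.
Qed.

Lemma piecewise_lipschitz (V : normedModType R) (I : finType)
    (D : I -> set V) (f : V -> R) (k : R) :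
  (forall x, exists i, D i x) ->
  (forall i, closed (D i)) ->
  (forall i x y, D i x -> D i y -> `|f x - f y| <= k * `|x - y|) ->
  forall x y, `|f x - f y| <= k * `|x - y|.
Proof.
move=> Dcov Dcl Df x y.
pose g (t : R) : V := y + t *: (x - y).
have gL s t : `|g s - g t| = `|x - y| * `|s - t|.
  by rewrite /g opprD addrACA subrr add0r -scalerBl normrZ mulrC.
have gc : continuous g.
  by apply: (@lipschitz_is_continuous _ _ _ _ `|x - y|) => s t; rewrite gL.
have := @piecewise_lipschitz_itv I (fun i => g @^-1` D i) (f \o g) (k * `|x - y|).
move=> /(_ _ _ (finset.setT : {set I}) 0 1).
rewrite /= /g scale0r addr0 scale1r subrKC subr0 mulr1; apply => //.
- by move=> i; move/continuous_closedP: gc; apply; exact: Dcl.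
- by move=> i s t Ds Dt; rewrite -mulrA -gL; exact: Df Ds Dt.
- by move=> t _; have [i Di] := Dcov (g t); exists i; rewrite ?inE.
Qed.

End Piecewise.

(** * Points of the complex and of the spherical hulls *)

Section Complex.
Context {R : realType} {n : nat}.
Notation V := 'rV[R]_n.+1.
Notation coefs := 'M[R]_(2, n).
Notation vertex := (@vertex n).
Implicit Types (c d : coefs) (p w : vertex -> V) (s t : {set vertex}).

Lemma in_vsupport c e i : ((e, i) \in vsupport c) = (c e i != 0).
Proof. by rewrite inE. Qed.

Lemma vsupport_eq0 c : (vsupport c == finset.set0) = (c == 0).
Proof.
apply/eqP/eqP => [c0|->]; last by apply/finset.setP => -[e i]; rewrite !inE mxE eqxx.
apply/matrixP => e i; rewrite mxE; apply/eqP/negPn.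
by rewrite -in_vsupport c0 inE.
Qed.

Lemma vsupport_sub c s :
  reflect (forall e i, (e, i) \notin s -> c e i = 0) (vsupport c \subset s).
Proof.
apply: (iffP fintype.subsetP) => [cs e i nes|cs [e i]].
  by apply/eqP; apply: contraNT nes => ce; apply: cs; rewrite in_vsupport.
by rewrite in_vsupport; apply: contraNT => /cs ->.
Qed.

Lemma admissible_simplex c : c != 0 -> admissible c -> simplex (vsupport c).
Proof.
move=> c0 [_ cc]; rewrite /simplex vsupport_eq0 c0; apply/forallP => i.
by rewrite !in_vsupport; case: (cc i) => ->; rewrite eqxx ?andbF.
Qed.

Lemma simplex_admissible c s : simplex s -> vsupport c \subset s ->
  (forall e i, 0 <= c e i) -> admissible c.
Proof.
move=> /andP[_ /forallP sp] /vsupport_sub cs c0; split => // i.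
have := sp i; rewrite negb_and => /orP[] h; [left|right]; exact: cs.
Qed.

Lemma sum_coefs c : \sum_(e < 2) \sum_(i < n) c e i = \sum_(v : vertex) c v.1 v.2.
Proof. by rewrite pair_bigA. Qed.

Lemma realKP c : realK c <-> admissible c /\ \sum_(v : vertex) c v.1 v.2 = 1.
Proof.
split=> [[c0 c1 cs]|[ca c1]].
  by rewrite -sum_coefs; split => //; exact: simplex_admissible cs (subxx _) c0.
have cn0 : c != 0.
  apply/eqP => cE; move: c1; rewrite cE big1 => [/eqP|v _].
    by rewrite eq_sym oner_eq0.
  by rewrite mxE.
split; [by case: ca|by rewrite sum_coefs|exact: admissible_simplex].
Qed.

Lemma comb_sub p c s : vsupport c \subset s ->
  comb p c = \sum_(v in s) c v.1 v.2 *: p v.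
Proof.
move=> /vsupport_sub cs; rewrite /comb [RHS]big_mkcond.
by apply: eq_bigr => -[e i] _; case: ifPn => // /cs ->; rewrite scale0r.
Qed.

Lemma hullP p s y : simplex s -> hull p s y <->
  sphere y /\ exists c, [/\ admissible c, vsupport c \subset s & y = comb p c].
Proof.
move=> ss; split=> [[ys [f [f0 yE]]]|[ys [c [ca cs yE]]]].
  split => //; pose c : coefs := \matrix_(e, i) if (e, i) \in s then f (e, i) else 0.
  have cs : vsupport c \subset s.
    by apply/vsupport_sub => e i /negbTE es; rewrite mxE es.
  exists c; split => //.
    by apply: simplex_admissible ss cs _ => e i; rewrite mxE; case: ifP.
  rewrite (comb_sub _ cs) yE; apply: eq_bigr => -[e i] es.
  by rewrite mxE es.
split => //; exists (fun v => c v.1 v.2); split; first by move=> v; case: ca.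
by rewrite yE; exact: comb_sub.
Qed.

Lemma combD p c d : comb p (c + d) = comb p c + comb p d.
Proof.
by rewrite /comb -big_split; apply: eq_bigr => v _; rewrite mxE scalerDl.
Qed.

Lemma combB p c d : comb p (c - d) = comb p c - comb p d.
Proof.
by rewrite -[c - d]/(c + -d) combD -(scaleN1r d) combZ scaleN1r.
Qed.

Lemma vpoint_realK v : realK (vpoint v : coefs).
Proof.
case: v => e i; apply/realKP; split.
  split => [e' j|j]; rewrite !mxE; first by case: (_ && _).
  by case: e => -[|[|//]] ?; [right|left]; case: eqP => // /(congr1 val).
rewrite (bigD1 (e, i))//= mxE !eqxx /= big1 ?addr0// => -[e' j] /= ne.
by rewrite mxE; case: andP => // -[/eqP ee /eqP jj]; rewrite ee jj eqxx in ne.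
Qed.

Lemma comb_vpoint p v : comb p (vpoint v) = p v.
Proof.
case: v => e i; rewrite /comb (bigD1 (e, i))//= mxE !eqxx scale1r.
rewrite big1 ?addr0// => -[e' j] /= ne.
rewrite mxE; case: andP; rewrite ?scale0r// => -[/eqP ee /eqP jj].
by rewrite ee jj eqxx in ne.
Qed.

(** The surface depends on the images of the vertices only: it is the trace on
    the sphere of the cones they span. *)
Lemma surface_comb (P : coefs -> V) :
  (forall s, simplex s -> P @` face s = hull (vimage P) s) ->
  forall y, surface P y <->
    sphere y /\ exists2 c, admissible c & y = comb (vimage P) c.
Proof.
move=> Ps y; split=> [[k kK <-]|[ys [c ca yE]]].
  have ks : simplex (vsupport k) by case: kK.
  have : hull (vimage P) (vsupport k) (P k).
    by rewrite -Ps//; exists k => //; split.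
  by move=> /(hullP _ _ ks)[ys [c [ca _ yE]]]; split => //; exists c.
have c0 : c != 0.
  apply/eqP => cE; move: (sphere_neq0 ys); rewrite yE cE comb0.
  by rewrite eqxx.
have cs := admissible_simplex c0 ca.
have : hull (vimage P) (vsupport c) y by apply/hullP => //; split => //; exists c.
by rewrite -Ps// => -[k [kK _] <-]; exists k.
Qed.

End Complex.

(** * Lipschitz coordinates in a complete simplicial fan *)

Lemma linear_lipschitz_rV (R : realType) N (W : normedModType R)
    (f : 'rV[R]_N -> W) : linear f ->
  exists2 k : R, 0 <= k & forall x y, `|f x - f y| <= k * `|x - y|.
Proof.
move=> flin; pose F : {linear 'rV[R]_N -> W} :=
  HB.pack f (GRing.isLinear.Build R 'rV[R]_N W *:%R f flin).
exists (\sum_j `|F (delta_mx 0 j)|); first exact: sumr_ge0.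
move=> x y; rewrite -[f x]/(F x) -[f y]/(F y) -linearB.
rewrite [in F _](row_sum_delta (x - y)) linear_sum mulr_suml.
apply: le_trans (ler_norm_sum _ _ _) _; apply: ler_sum => j _.
by rewrite linearZ normrZ mulrC ler_wpM2l// coord_le_norm.
Qed.

Section Independence.
Context {R : realType} {n : nat}.
Notation V := 'rV[R]_n.+1.
Notation coefs := 'M[R]_(2, n).
Notation vertex := (@vertex n).
Implicit Types (c d : coefs) (p w : vertex -> V) (s t : {set vertex}).

Definition comb_injective p :=
  forall c d, admissible c -> admissible d -> comb p c = comb p d -> c = d.

(** A linear relation between the vectors of a face equates two nonnegative
    combinations of them, its positive and its negative part. *)
Lemma face_independent p s c : comb_injective p -> simplex s ->
  vsupport c \subset s -> comb p c = 0 -> c = 0.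
Proof.
move=> pinj ss cs pc0.
pose cp : coefs := \matrix_(e, i) Num.max (c e i) 0.
pose cm : coefs := \matrix_(e, i) Num.max (- c e i) 0.
have cE : c = cp - cm.
  by apply/matrixP => e i; rewrite !mxE; case: (leP (c e i) 0) => ce;
    case: (leP (- c e i) 0) => ce'; lra.
have sub (x : coefs) : (forall e i, c e i = 0 -> x e i = 0) -> vsupport x \subset s.
  move=> xc; apply/vsupport_sub => e i es; apply: xc.
  by move/vsupport_sub: cs; exact.
have ap : admissible cp.
  apply: simplex_admissible ss (sub _ _) _ => e i; rewrite mxE ?le_max ?lexx ?orbT//.
  by move=> ->; rewrite maxxx.
have am : admissible cm.
  apply: simplex_admissible ss (sub _ _) _ => e i; rewrite mxE ?le_max ?lexx ?orbT//.
  by move=> ->; rewrite oppr0 maxxx.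
move: pc0; rewrite cE combB => /eqP; rewrite subr_eq0 => /eqP /pinj -> //.
by rewrite subrr.
Qed.

Definition mask s c : coefs := \matrix_(e, i) if (e, i) \in s then c e i else 0.

(** The second component makes the map injective on all matrices. *)
Definition mask_comb p s c : (V * coefs)%type := (comb p (mask s c), c - mask s c).

Lemma mask_comb_linear p s : linear (mask_comb p s).
Proof.
move=> a c d; have maskL : mask s (a *: c + d) = a *: mask s c + mask s d.
  by apply/matrixP => e i; rewrite !mxE; case: ifP; rewrite ?mulr0 ?addr0.
congr (_, _); rewrite maskL ?combD ?combZ//.
by rewrite /= scalerBr opprD addrACA.
Qed.

HB.instance Definition _ p s :=
  GRing.isLinear.Build R coefs (V * coefs)%type *:%R (mask_comb p s)
    (mask_comb_linear p s).

Lemma face_left_inverse p s : comb_injective p -> simplex s ->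
  exists k, exists2 M : V -> coefs,
    0 <= k /\ (forall x y, `|M x - M y| <= k * `|x - y|) &
    forall c, vsupport c \subset s -> M (comb p c) = c.
Proof.
move=> pinj ss; pose h := linfun (mask_comb p s).
have maskE c : vsupport c \subset s -> mask s c = c.
  move=> /vsupport_sub cs; apply/matrixP => e i; rewrite mxE.
  by case: ifPn => // /cs.
have hinj : lker h == 0%VS.
  rewrite -subv0; apply/subvP => c; rewrite memv_ker memv0 lfunE /= => /eqP.
  rewrite /mask_comb => -[pc /eqP]; rewrite subr_eq0 => /eqP cE; apply/eqP.
  apply: (face_independent pinj ss); last by rewrite cE.
  by apply/vsupport_sub => e i /negbTE es; rewrite cE mxE es.
pose M (x : V) : coefs := (h^-1)%VF (x, 0).
have Mlin : linear M.
  move=> a x y; rewrite /M -linearP; congr (_ _).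
  by congr (_, _); rewrite /= scaler0 addr0.
have [k k0 Mk] := linear_lipschitz_rV Mlin.
exists k, M => // c cs.
have hE : h c = (comb p c, 0) by rewrite lfunE /= /mask_comb maskE// subrr.
by rewrite /M -hE lker0_lfunK.
Qed.

End Independence.

Section CompleteFan.
Context {R : realType} {n : nat}.
Notation V := 'rV[R]_n.+1.
Notation coefs := 'M[R]_(2, n).
Notation vertex := (@vertex n).
Implicit Types (c d : coefs) (p w : vertex -> V) (s t : {set vertex}).

Lemma comb_lipschitz p : exists2 k : R, 0 <= k &
  forall c d, `|comb p c - comb p d| <= k * `|c - d|.
Proof.
exists (\sum_v `|p v|); first exact: sumr_ge0.
move=> c d; rewrite -combB mulr_suml; apply: le_trans (ler_norm_sum _ _ _) _.
by apply: ler_sum => v _; rewrite normrZ mulrC ler_wpM2l// coord_le_norm.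
Qed.

Lemma subset_simplex c : (0 < n)%N -> admissible c ->
  exists2 s, simplex s & vsupport c \subset s.
Proof.
move=> n0 ca; have [->|c0] := eqVneq c 0.
  pose i0 := Ordinal n0.
  exists (vsupport (vpoint (0, i0) : coefs)).
    by case: (vpoint_realK (R := R) (0, i0)).
  by apply/vsupport_sub => e i _; rewrite mxE.
by exists (vsupport c) => //; exact: admissible_simplex.
Qed.

(** On each cone of the fan the coordinates are the restriction of a linear
    map, and the cones are closed; so the coordinates are globally Lipschitz. *)
Lemma complete_fan_coordinates (m : V) w : (0 < n)%N -> sphere m ->
  (forall v, dot (w v) m = 0) -> comb_injective w ->
  (forall x, dot x m = 0 -> exists2 c, admissible c & x = comb w c) ->
  exists coef K, fan_coordinates m w coef K.
Proof.
move=> n0 ms worth winj wfull.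
pose h (x : V) : V := x - dot x m *: m.
have hm x : dot (h x) m = 0 by rewrite dotBl dotZl [dot m m]ms mulr1 subrr.
have /choice[coef coefP] x : exists c, admissible c /\ h x = comb w c.
  by have [c ca cE] := wfull _ (hm x); exists c.
have coefE x c : admissible c -> h x = comb w c -> coef x = c.
  by move=> ca; have [cxa ->] := coefP x; exact: winj.
have [kh kh0 hL] : exists2 k : R, 0 <= k & forall x y, `|h x - h y| <= k * `|x - y|.
  apply: linear_lipschitz_rV => a x y; rewrite /h dotDl dotZl.
  rewrite scalerDl scalerBr scalerA opprD.
  by rewrite addrACA.
have [kw kw0 wL] := comb_lipschitz w.
have inv s : exists kM : R * (V -> coefs), simplex s ->
    [/\ 0 <= kM.1, forall x y, `|kM.2 x - kM.2 y| <= kM.1 * `|x - y| &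
        forall c, vsupport c \subset s -> kM.2 (comb w c) = c].
  have [ss|] := boolP (simplex s); last by exists (0, fun=> 0).
  by have [k [M [k0 ML] Mc]] := face_left_inverse winj ss; exists (k, M).
have [kM kMP] := choice inv.
pose D s := [set x : V | simplex s /\ vsupport (coef x) \subset s].
have Dlip s x y e i : D s x -> D s y ->
    `|coef x e i - coef y e i| <= (\sum_(s | simplex s) (kM s).1) * kh * `|x - y|.
  move=> [ss xs] [_ ys]; have [k0 ML Mc] := kMP s ss.
  rewrite -(Mc _ xs) -(Mc _ ys) -!(proj2 (coefP _)).
  have := coord_le_norm ((kM s).2 (h x) - (kM s).2 (h y)) e i.
  rewrite !mxE => /le_trans; apply; apply: le_trans (ML _ _) _.
  rewrite -mulrA; apply: ler_pM => //.
  rewrite (bigD1 s)//= lerDl; apply: sumr_ge0 => t /andP[ts _].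
  by have [] := kMP t ts.
have Dcl s : closed (D s).
  have [ss|nss] := boolP (simplex s); last first.
    by have -> : D s = set0; [by rewrite -subset0 => x [/(negP nss)]|exact: closed0].
  have [k0 ML Mc] := kMP s ss.
  pose M x := (kM s).2 (h x).
  have McL x y : `|M x - M y| <= (kM s).1 * kh * `|x - y|.
    by apply: le_trans (ML _ _) _; rewrite -mulrA; exact: ler_wpM2l.
  pose g x := `|comb w (M x) - h x|.
  have gc : continuous g.
    apply: (@lipschitz_is_continuous _ _ _ _ (kw * ((kM s).1 * kh) + kh)) => x y.
    apply: le_trans (ler_dist_dist _ _) _.
    have -> : comb w (M x) - h x - (comb w (M y) - h y) =
        (comb w (M x) - comb w (M y)) + (h y - h x).
      move: (comb _ _) (comb _ _) (h x) (h y) => a b u v.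
      by apply/rowP => j; rewrite !mxE; ring.
    apply: le_trans (ler_normD _ _) _; rewrite mulrDl.
    apply: lerD; last by rewrite distrC; exact: hL.
    by apply: le_trans (wL _ _) _; rewrite -[leRHS]mulrA; exact: ler_wpM2l.
  have Mcc e i : continuous (fun x => M x e i).
    apply: (@lipschitz_is_continuous _ _ _ _ ((kM s).1 * kh)) => x y.
    have := coord_le_norm (M x - M y) e i.
    by rewrite !mxE => /le_trans; apply.
  pose N v := if v \in s then setT else [set x | M x v.1 v.2 <= 0].
  have -> : D s = (g @^-1` [set t | t <= 0]) `&`
      \bigcap_(v in [set: vertex]) ([set x | 0 <= M x v.1 v.2] `&` N v).
    apply/seteqP; split=> [x [_ xs]|x [/= gx Mx]].
      have [[c0 _] hx] := coefP x.
      have Mx : M x = coef x by rewrite /M hx Mc.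
      split; first by rewrite /= /g Mx hx subrr normr0.
      move=> [e i] _; split; first by rewrite /= Mx.
      rewrite /N; case: ifPn => //= es.
      by move/vsupport_sub: xs => /(_ e i es) xs; rewrite Mx xs.
    have M0 e i : 0 <= M x e i by have [] := Mx (e, i) I.
    have Ms : vsupport (M x) \subset s.
      apply/vsupport_sub => e i /negbTE es; have [_] := Mx (e, i) I.
      by rewrite /N es /= => Mle; apply/eqP; rewrite eq_le Mle M0.
    have hx : h x = comb w (M x).
      by apply/eqP; rewrite eq_sym -subr_eq0 -normr_le0.
    by split => //; rewrite (coefE x (M x)) //; exact: simplex_admissible Ms M0.
  apply: closedI.
    by move/continuous_closedP: gc; apply; exact: closed_le.
  apply: closed_bigI => -[e i] _; apply: closedI.
    by have /continuous_closedP := Mcc e i; move=> /(_ _ (@closed_ge R 0)).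
  rewrite /N; case: ifP => _; first exact: closedT.
  by have /continuous_closedP := Mcc e i; move=> /(_ _ (@closed_le R 0)).
exists coef, ((\sum_(s | simplex s) (kM s).1) * kh); split => //.
- by move=> x; case: (coefP x).
- by move=> x; rewrite -(proj2 (coefP x)) subrK.
- move=> c a ca; apply: coefE => //; rewrite /h.
  rewrite dotDl dotZl [dot m m]ms mulr1 dot_comb big1 => [|v _].
    by rewrite add0r addrK.
  by rewrite worth mulr0.
- rewrite mulr_ge0// sumr_ge0// => s ss; by have [] := kMP s ss.
- move=> x y e i; apply: (piecewise_lipschitz (D := D) (f := fun x => coef x e i)).
  + by move=> z; have [s ss zs] := subset_simplex n0 (proj1 (coefP z)); exists s.
  + exact: Dcl.
  + by move=> s a b Da Db; exact: Dlip Da Db.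
Qed.

End CompleteFan.

(** * General position *)

Section GeneralPosition.
Context {R : realType} {n : nat}.
Notation V := 'rV[R]_n.+1.
Notation coefs := 'M[R]_(2, n).
Notation vertex := (@vertex n).
Implicit Types (c d : coefs) (p w : vertex -> V) (s t : {set vertex}).

Lemma subspace_of_dim (U : {vspace V}) (d : nat) : (\dim U <= d <= n.+1)%N ->
  exists2 L : {vspace V}, \dim L = d & (U <= L)%VS.
Proof.
elim: d => [|d IH] /andP[Ud dn].
  by exists U => //; apply/eqP; rewrite -leqn0.
move: Ud; rewrite leq_eqVlt => /orP[/eqP Ud|Ud]; first by exists U.
have [L Ld UL] := IH (introT andP (conj Ud (ltnW dn))).
have /subvPn[x _ xL] : ~~ (fullv <= L)%VS.
  apply: contraL dn => /dimvS; rewrite dimvf /dim /= mul1n Ld => nd.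
  by rewrite -leqNgt.
exists (L + <[x]>)%VS; last exact: subv_trans UL (addvSl _ _).
rewrite dimv_disjoint_sum; last first.
  apply/eqP; rewrite -subv0; apply/subvP => y.
  rewrite memv_cap memv0 => /andP[yL /vlineP[k yE]]; apply/eqP.
  have [k0|k0] := eqVneq k 0; first by rewrite yE k0 scale0r.
  by move: yL; rewrite yE rpredZeq (negbTE k0) (negbTE xL).
rewrite dim_vline Ld; have -> : x != 0 by apply: contraNneq xL => ->; exact: mem0v.
by rewrite addn1.
Qed.

Lemma card_simplex s : simplex s -> (#|s| <= n)%N.
Proof.
move=> /andP[_ /forallP sp].
have sinj : {in s &, injective (fun v : vertex => v.2)}.
  move=> [e i] [f j] es fs /= ij; rewrite -ij in fs *; congr (_, _).
  have := sp i; case: e es => -[|[|//]] e2 es; case: f fs => -[|[|//]] f2 fs.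
  - by move=> _; exact: val_inj.
  - rewrite (_ : (0, i) = (Ordinal e2, i)) ?es; last by congr (_, _); exact: val_inj.
    by rewrite (_ : (1, i) = (Ordinal f2, i)) ?fs//; congr (_, _); exact: val_inj.
  - rewrite (_ : (0, i) = (Ordinal f2, i)) ?fs; last by congr (_, _); exact: val_inj.
    by rewrite (_ : (1, i) = (Ordinal e2, i)) ?es//; congr (_, _); exact: val_inj.
  - by move=> _; exact: val_inj.
rewrite -(card_in_imset sinj) -[leqRHS]card_ord.
exact: max_card.
Qed.

Lemma general_position_independent (w : vertex -> V) s c : simplex s ->
  ~ in_plane #|s|.-1 (w @` [set` s]) ->
  vsupport c \subset s -> comb w c = 0 -> c = 0.
Proof.
move=> ss gp cs wc0; apply/eqP; rewrite -vsupport_eq0.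
apply/negPn/negP => /set0Pn[v0 v0c]; apply: gp.
have v0s : v0 \in s by exact: (fintype.subsetP cs).
pose U := <<[seq w v | v <- enum (s :\ v0)]>>%VS.
have Uw v : v \in s -> v != v0 -> w v \in U.
  move=> vs vv0; apply: memv_span; apply/mapP; exists v => //.
  by rewrite mem_enum !inE vv0.
have Ud : (\dim U <= #|s|.-1)%N.
  apply: leq_trans (dim_span _) _.
  by rewrite size_map -cardE [in leqRHS](cardsD1 v0) v0s.
have [|L Ld UL] := @subspace_of_dim U #|s|.-1.
  rewrite Ud (leq_trans (leq_pred _))// (leq_trans (card_simplex ss))//.
exists L; split => // _ [v /= vs <-]; apply: (subvP UL).
have [->|vv0] := eqVneq v v0; last exact: Uw.
move: wc0; rewrite (comb_sub _ cs) (bigD1 v0)//= => /eqP; rewrite addr_eq0 => /eqP cw.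
have c0 : c v0.1 v0.2 != 0 by move: v0c; rewrite inE.
rewrite -[w v0]scale1r -(mulVf c0) -scalerA cw; apply: memvZ; rewrite memvN.
by apply: memv_suml => u /andP[us uv0]; apply: memvZ; exact: Uw.
Qed.

Lemma comb_sum p (I : finType) (f : I -> coefs) :
  comb p (\sum_i f i) = \sum_i comb p (f i).
Proof.
apply: (big_morph (comb p)); last exact: comb0.
by move=> c d; exact: combD.
Qed.

Lemma card_independent p s (L : {vspace V}) :
  (forall c, vsupport c \subset s -> comb p c = 0 -> c = 0) ->
  (forall v, v \in s -> p v \in L) -> (#|s| <= \dim L)%N.
Proof.
move=> ind pL; pose X := mktuple (fun i : 'I_#|s| => p (enum_val i)).
have fX : free X.
  apply/freeP => k kX j.
  pose c : coefs := \sum_i k i *: vpoint (enum_val i).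
  have cE (v : vertex) : c v.1 v.2 = \sum_(i | enum_val i == v) k i.
    rewrite summxE [RHS]big_mkcond; apply: eq_bigr => i _; rewrite !mxE.
    case: v => e a; case: (enum_val i) => f b /=; rewrite xpair_eqE.
    by rewrite (eq_sym e) (eq_sym a); case: ifP; rewrite ?mulr1 ?mulr0.
  have c0 : c = 0.
    apply: ind.
      apply/vsupport_sub => e a nes; rewrite (cE (e, a)) big1// => i /eqP ie.
      by move: nes; rewrite -ie enum_valP.
    rewrite comb_sum -[RHS]kX; apply: eq_bigr => i _.
    by rewrite combZ comb_vpoint -tnth_nth tnth_mktuple.
  have := cE (enum_val j); rewrite c0 mxE => /esym.
  by rewrite (bigD1 j)//= big1 ?addr0// => i /andP[/eqP/enum_val_inj ->]; rewrite eqxx.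
move: fX; rewrite /free size_tuple => /eqP <-; apply: dimvS; apply/span_subvP => x.
by move=> /tnthP[i ->]; rewrite tnth_mktuple pL// enum_valP.
Qed.

Lemma comb_injective_general_position p s : comb_injective p -> simplex s ->
  ~ in_plane #|s|.-1 (p @` [set` s]).
Proof.
move=> pinj ss [L [Ld Lp]].
have : (#|s| <= \dim L)%N.
  apply: (@card_independent p) => [c|v vs]; first exact: face_independent.
  by apply: Lp; exists v.
rewrite Ld; case: #|s| (cards_eq0 s) => [|k _]; last by rewrite ltnn.
by rewrite eqxx => /esym s0; move/andP: ss; rewrite s0 => -[].
Qed.

End GeneralPosition.

(** * Polyhedra close to an equatorial one *)

Section NearEquator.
Context {R : realType} {n : nat}.
Notation V := 'rV[R]_n.+1.
Notation coefs := 'M[R]_(2, n).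
Notation vertex := (@vertex n).
Implicit Types (c d : coefs) (p w : vertex -> V) (s t : {set vertex}).

Definition spherical_faces (P : coefs -> V) :=
  forall s, simplex s -> P @` face s = hull (vimage P) s.

Lemma surface_ge (P : coefs -> V) m b : spherical_faces P -> 0 <= b ->
  (forall v, sphere (vimage P v) /\ b <= dot (vimage P v) m) ->
  surface P `<=` [set y | b <= dot y m].
Proof.
move=> Pf b0 Pb y /(surface_comb Pf)[ys [c [c0 _] yE]] /=.
have sc : 1 <= \sum_(v : vertex) c v.1 v.2.
  rewrite -[leLHS]ys {1}yE dot_comb; apply: ler_sum => v _.
  by rewrite ler_piMr// dot_sphere_le1//; case: (Pb v).
apply: (@le_trans _ _ (\sum_(v : vertex) c v.1 v.2 * b)).
  by rewrite -mulr_suml ler_peMl.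
by rewrite yE dot_comb; apply: ler_sum => v _; rewrite ler_wpM2l//; case: (Pb v).
Qed.

(** The height of a point is the sum of the heights of the vertices
    weighted by bounded coordinates, so the surface at [u1] stays above some
    level [b], while a surface closer to the equator stays below [b / 2]. *)
Lemma volume_nonconstant m e w coef K (P : R -> coefs -> V) (u0 : R) :
  sphere m -> sphere e -> dot e m = 0 -> fan_coordinates m w coef K ->
  (forall eps : R, 0 < eps -> exists u, [/\ 0 < u < u0,
    spherical_faces (P u), surface (P u) `<=` upper m &
    forall v, `|vimage (P u) v - w v| <= eps]) ->
  exists u1 u2 : R, [/\ 0 < u1 < u0, 0 < u2 < u0,
    (sphere_volume (pole_part m (P u1)) < sphere_volume (pole_part m (P u2)))%E &
    (sphere_volume (far_part m (P u1)) < sphere_volume (far_part m (P u2)))%E].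
Proof.
move=> ms es em fan near_w; have K0 := fan_lip_ge0 fan.
pose k := (n.*2)%:R * K; have k0 : 0 <= k by rewrite mulr_ge0.
pose e0 := 2^-1 / (k + 1).
have e00 : 0 < e0 by rewrite divr_gt0// ltr_wpDl.
have e0k (x : R) : x <= e0 -> (n.*2)%:R * (K * x) <= 2^-1.
  move=> xe; rewrite mulrA -/k; apply: le_trans (ler_wpM2l k0 xe) _.
  rewrite /e0 mulrCA ler_piMr ?invr_ge0// ler_pdivrMr ?ltr_wpDl//; lra.
have sep u x : x <= e0 -> spherical_faces (P u) ->
    (forall v, `|vimage (P u) v - w v| <= x) -> separates_poles m (surface (P u)).
  move=> xe Pf Pw; apply: (perturbed_fan_separates ms fan Pw (e0k _ xe)) => c ca cs.
  by apply/(surface_comb Pf); split => //; exists c.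
have [u1 [u1b P1f P1u P1w]] := near_w e0 e00.
pose b := \big[Num.min/1]_v dot (vimage (P u1) v) m.
have vu v : upper m (vimage (P u1) v) by apply: P1u; exists (vpoint v) => //; exact: vpoint_realK.
have b0 : 0 < b by apply: lt_bigmin => // v _; case: (vu v).
have b1 : b <= 1 by exact: bigmin_le_id.
have S1 : surface (P u1) `<=` [set y | b <= dot y m].
  apply: surface_ge => //; first exact: ltW.
  by move=> v; split; [case: (vu v)|exact: bigmin_le_cond].
pose q := (n.*2)%:R * (2 * K * n.+1%:R); have q0 : 0 <= q by rewrite !mulr_ge0.
pose e1 := Num.min e0 (b / 2 / (q + 1)).
have e10 : 0 < e1 by rewrite lt_min e00 !divr_gt0// ltr_wpDl.
have e1e0 : e1 <= e0 by rewrite ge_min lexx.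
have [u2 [u2b P2f P2u P2w]] := near_w e1 e10.
have S2 : surface (P u2) `<=` [set y | dot y m <= b / 2].
  move=> y /(surface_comb P2f)[ys [c ca yE]] /=.
  have h v : `|dot (vimage (P u2) v) m| <= n.+1%:R * e1.
    rewrite -[vimage _ _](subrK (w v)) dotDl (fan_orth fan) addr0.
    apply: le_trans (dot_le_norm _ _) _; apply: ler_wpM2l => //.
    by rewrite -[leRHS]mulr1; apply: ler_pM => //; exact: sphere_norm_le1.
  have := perturbed_height fan P2w (e0k _ e1e0) ca _ h.
  rewrite -yE => /(_ ys) yh; apply: le_trans (ler_norm _) _; apply: le_trans yh _.
  rewrite !mulrA -(mulrA _ 2) -(mulrA _ (2 * K)) -/q.
  have e1q : e1 <= b / 2 / (q + 1) by rewrite ge_min lexx orbT.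
  apply: le_trans (ler_wpM2l q0 e1q) _.
  rewrite mulrCA ler_piMr ?divr_ge0// ?(ltW b0)// ler_pdivrMr ?ltr_wpDl//; lra.
have sep1 := sep _ _ (lexx _) P1f P1w; have sep2 := sep _ _ e1e0 P2f P2w.
have hb : [/\ 0 < b / 2, b / 2 < b & -1 <= b / 2] by split; lra.
have [h1 h2 h3] := hb.
exists u1, u2; split => //; apply: (sphere_volume_lt_caps ms es em h1 h2 b1).
- exact: pole_part_sub.
- exact: pole_part_sup.
- exact: far_part_sub.
- exact: far_part_sup.
Qed.

End NearEquator.

(** * Flexible polyhedra through the equator *)

Section Equatorial.
Context {R : realType} {n : nat}.
Notation V := 'rV[R]_n.+1.
Notation coefs := 'M[R]_(2, n).
Notation vertex := (@vertex n).
Implicit Types (c d : coefs) (p w : vertex -> V) (s t : {set vertex}).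

(** A point of two faces comes from a common point of the complex, hence lies
    in the image of their intersection; independence in both faces then gives
    the uniqueness of coordinates. *)
Lemma equatorial_comb_injective (P : coefs -> V) : spherical_faces P ->
  (forall s, simplex s -> general_position P s) ->
  {in [set k | realK k] &, injective P} -> comb_injective (vimage P).
Proof.
move=> Pf Pg Pinj.
have ind s c : simplex s -> vsupport c \subset s -> comb (vimage P) c = 0 -> c = 0.
  by move=> ss; apply: general_position_independent => //; exact: Pg.
have zero c : admissible c -> comb (vimage P) c = 0 -> c = 0.
  move=> ca cP; have [//|c0] := eqVneq c 0.
  exact: ind (admissible_simplex c0 ca) (subxx _) cP.
move=> c d ca da cd; have [y0|y0] := eqVneq (comb (vimage P) c) 0.
  by rewrite (zero c)// (zero d)// -cd.
have c0 : c != 0 by apply: contraNneq y0 => ->; rewrite comb0.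
have d0 : d != 0 by rewrite cd in y0; apply: contraNneq y0 => ->; rewrite comb0.
have cs := admissible_simplex c0 ca; have ds := admissible_simplex d0 da.
pose N := Num.sqrt (dot (comb (vimage P) c) (comb (vimage P) c)).
have N0 : 0 < N by rewrite sqrtr_gt0 dot_gt0.
have N2 : N ^+ 2 = dot (comb (vimage P) c) (comb (vimage P) c).
  by rewrite sqr_sqrtr// dot_ge0.
have Ni : 0 <= N^-1 by rewrite invr_ge0 ltW.
pose y := N^-1 *: comb (vimage P) c.
have ys : sphere y.
  by rewrite /sphere /= dotZl dotZr -N2 expr2 mulKf ?gt_eqF// mulVf ?gt_eqF.
have supZ x : vsupport (N^-1 *: x : coefs) \subset vsupport x.
  apply/vsupport_sub => e i; rewrite in_vsupport negbK mxE => /eqP ->.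
  by rewrite mulr0.
have hc : hull (vimage P) (vsupport c) y.
  apply/hullP => //; split => //; exists (N^-1 *: c).
  by rewrite combZ supZ; split => //; exact: admissibleZ.
have hd : hull (vimage P) (vsupport d) y.
  apply/hullP => //; split => //; exists (N^-1 *: d).
  by rewrite combZ -cd supZ; split => //; exact: admissibleZ.
move: hc hd; rewrite -!Pf// => -[k [kK kc] ky] [k' [k'K kd] k'y].
have kk' : k = k' by apply: Pinj; rewrite ?inE// ky.
rewrite -kk' in kd; have ks : simplex (vsupport k) by case: kK.
have : hull (vimage P) (vsupport k) y by rewrite -Pf//; exists k => //; split.
move=> /(hullP _ _ ks)[_ [x [_ xs yx]]].
have xE z : simplex (vsupport z) -> vsupport k \subset vsupport z ->
    comb (vimage P) c = comb (vimage P) z -> N^-1 *: z = x.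
  move=> zs kz cz; apply/eqP; rewrite -subr_eq0; apply/eqP; apply: ind zs _ _.
    apply/vsupport_sub => e i niz.
    move: (niz); rewrite in_vsupport negbK => /eqP zei.
    have /vsupport_sub/(_ e i niz) xei := fintype.subset_trans xs kz.
    by rewrite !mxE zei xei mulr0 subrr.
  by rewrite combB combZ -cz -yx subrr.
have : N^-1 *: c = N^-1 *: d by rewrite !xE.
by apply: scalerI; rewrite gt_eqF ?invr_gt0.
Qed.

Lemma equatorial_fan (m : V) (P : coefs -> V) : (0 < n)%N -> sphere m ->
  homeo_onto realK (equator m) P -> spherical_faces P ->
  (forall s, simplex s -> general_position P s) ->
  exists coef K, fan_coordinates m (vimage P) coef K.
Proof.
move=> n0 ms [_ PE [g [_ gP]]] Pf Pg.
have Pinj : {in [set k | realK k] &, injective P}.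
  by move=> x y /[!inE] xK yK xy; rewrite -(gP x)// -(gP y)// xy.
apply: complete_fan_coordinates => //.
- move=> v; suff [] : equator m (vimage P v) by [].
  by rewrite -PE; exists (vpoint v) => //; exact: vpoint_realK.
- exact: equatorial_comb_injective.
move=> x xm; have [->|x0] := eqVneq x 0.
  by exists 0; [exact: admissible0|rewrite comb0].
pose N := Num.sqrt (dot x x).
have N0 : 0 < N by rewrite sqrtr_gt0 dot_gt0.
have N2 : N ^+ 2 = dot x x by rewrite sqr_sqrtr// dot_ge0.
have : equator m (N^-1 *: x).
  split; last by rewrite dotZl xm mulr0.
  by rewrite /sphere /= dotZl dotZr -N2 expr2 mulKf ?gt_eqF// mulVf ?gt_eqF.
rewrite -PE => Sx; have /(surface_comb Pf)[_ [c ca xE]] : surface P (N^-1 *: x) := Sx.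
exists (N *: c); first by apply: admissibleZ => //; exact: ltW.
by rewrite combZ -xE scalerA mulfV ?gt_eqF// scale1r.
Qed.

Lemma avoid_seq (s : seq (option R)) :
  exists2 r : R, 0 < r & forall u, 0 < u < r -> Some u \notin s.
Proof.
elim: s => [|o s [r r0 rs]]; first by exists 1.
case: o => [v|]; last first.
  by exists r => // u ur; rewrite inE /= rs.
exists (if 0 < v then Num.min v r else r); first by case: ifP => // v0; rewrite lt_min v0.
move=> u /andP[u0 ur]; rewrite inE negb_or rs ?andbT.
  apply/eqP => -[uv]; move: ur; rewrite -uv u0 lt_min ltxx.
  by [].
by rewrite u0; case: ifP ur => // _; rewrite lt_min => /andP[].
Qed.

(** Only finitely many positions are degenerate and the vertices move
    continuously, so nondegenerate positions occur arbitrarily close to the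
    equatorial one. *)
Lemma flexible_through_equator (m : V)
    (P : one_point_compactification R -> coefs -> V) (u0 : R) :
  (0 < n)%N -> sphere m ->
  flexible [set: one_point_compactification R] P ->
  homeo_onto realK (equator m) (P (Some 0)) ->
  spherical_faces (P (Some 0)) ->
  (forall s, simplex s -> general_position (P (Some 0)) s) ->
  (forall u : R, 0 < u -> surface (P (Some u)) `<=` upper m) -> 0 < u0 ->
  exists u1 u2 : R, [/\ 0 < u1 < u0, 0 < u2 < u0 &
    (sphere_volume (pole_part m (P (Some u1))) <
     sphere_volume (pole_part m (P (Some u2))))%E].
Proof.
move=> n0 ms [[Pc _] Pfin _ _] P0 P0f P0g Pu u00.
have [coef [K fan]] := equatorial_fan n0 ms P0 P0f P0g.
have [e [es em]] : exists e, equator m e.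
  have [_ PE _] := P0; exists (P (Some 0) (vpoint (0, Ordinal n0))).
  by rewrite -PE; exists (vpoint (0, Ordinal n0)) => //; exact: vpoint_realK.
have [r r0 Pnd] : exists2 r : R, 0 < r &
    forall u, 0 < u < r -> nondegenerate_polyhedron (P (Some u)).
  move/finite_seqP: Pfin => [bad badE].
  have [r r0 rP] := avoid_seq bad; exists r => // u ur.
  apply: contrapT => nu; have : [set` bad] (Some u) by rewrite -badE.
  by move=> /=; apply/negP; exact: rP.
have vc v : vimage (P (Some u)) v @[u --> (0 : R)] --> vimage (P (Some 0)) v.
  have vK := vpoint_realK (R := R) v.
  have /subspace_continuousP/(_ (Some 0, vpoint v)) Pv := Pc.
  pose h (u : R) : one_point_compactification R * coefs := (Some u, vpoint v).
  have hc : h u @[u --> (0 : R)] -->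
      within (setT `*` realK) (nbhs ((Some 0, vpoint v) : one_point_compactification R * coefs)).
    move=> W [[W1 W2] /= [n1 n2] WP].
    have n1' : \forall u \near (0 : R), W1 (Some u) by exact: n1.
    apply: filterS n1' => u W1u; apply: (WP (h u)).
      by split => //; exact: nbhs_singleton.
    by split.
  exact: (cvg_comp _ _ hc (Pv (conj I vK))).
have := volume_nonconstant (P := fun u => P (Some u)) (u0 := u0) ms es em fan.
case=> [eps eps0|u1 [u2 [h1 h2 h3 _]]]; last by exists u1, u2.
have : \forall u \near (0 : R), forall v : vertex,
    `|vimage (P (Some u)) v - vimage (P (Some 0)) v| <= eps.
  apply: (@filter_forall R vertex _ (nbhs (0 : R))) => v.
  near=> u; rewrite distrC; near: u.
  exact: (@cvgr_dist_le _ _ _ _ _ _ _ (vc v) _ eps0).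
move=> /nbhs_ballP[r' /= r'0 r'P].
pose u := Num.min (Num.min r r') u0 / 2.
have m0 : 0 < Num.min (Num.min r r') u0 by rewrite !lt_min r0 r'0 u00.
have uu : 0 < u by rewrite divr_gt0.
have um : u < Num.min (Num.min r r') u0 by rewrite /u; lra.
move: um; rewrite !lt_min => /andP[/andP[ur ur'] uu0].
have [_ und _] : nondegenerate_polyhedron (P (Some u)) by apply: Pnd; rewrite uu.
exists u; split; [by rewrite uu|by move=> s /und[_ []]|exact: Pu|].
by apply: r'P; rewrite /ball /= sub0r normrN gtr0_norm.
Unshelve. all: by end_near. Qed.

End Equatorial.

(** * The polyhedron with given vertex rays *)

Section Normalize.
Context {R : realType} {N : nat}.
Implicit Types x y : 'rV[R]_N.

Definition normalize x := (Num.sqrt (dot x x))^-1 *: x.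

Lemma sqrt_dot_gt0 x : (0 < Num.sqrt (dot x x)) = (x != 0).
Proof. by rewrite sqrtr_gt0 dot_gt0. Qed.

Lemma normalize_sphere x : x != 0 -> sphere (normalize x).
Proof.
rewrite -sqrt_dot_gt0 => x0; rewrite /sphere /= dotZl dotZr.
by rewrite -{3}(sqr_sqrtr (dot_ge0 x)) expr2 mulKf ?gt_eqF// mulVf ?gt_eqF.
Qed.

Lemma normalize_id x : sphere x -> normalize x = x.
Proof. by move=> xs; rewrite /normalize [dot x x]xs sqrtr1 invr1 scale1r. Qed.

Lemma normalizeZ a x : 0 < a -> normalize (a *: x) = normalize x.
Proof.
move=> a0; have [->|x0] := eqVneq x 0; first by rewrite /normalize !scaler0.
rewrite /normalize dotZl dotZr mulrA -expr2 sqrtrM ?sqr_ge0// sqrtr_sqr.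
by rewrite gtr0_norm// scalerA invfM -mulrA mulrCA mulVf ?gt_eqF// mulr1.
Qed.

Lemma cvg_normalize (T : Type) (F : set_system T) {FF : Filter F}
    (f : T -> 'rV[R]_N) (a : 'rV[R]_N) : a != 0 ->
  f x @[x --> F] --> a -> normalize (f x) @[x --> F] --> normalize a.
Proof.
move=> a0 fa; apply: cvgZ => //; apply: cvgV; first by rewrite gt_eqF// sqrt_dot_gt0.
exact: (cvg_comp _ _ (cvg_dot fa fa) (@sqrt_continuous R (dot a a))).
Qed.

End Normalize.

Section Conic.
Context {R : realType} {n : nat}.
Notation V := 'rV[R]_n.+1.
Notation coefs := 'M[R]_(2, n).
Notation vertex := (@vertex n).
Implicit Types (c d k : coefs) (p w : vertex -> V) (s t : {set vertex}).

(** The affine map of each simplex of the complex, followed by the central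
    projection to the sphere. *)
Definition conic p k : V := normalize (comb p k).

Lemma cvg_comb (T : Type) (F : set_system T) {FF : Filter F}
    (p : T -> vertex -> V) (c : T -> coefs) p0 (c0 : coefs) :
  (forall v, p x v @[x --> F] --> p0 v) -> c x @[x --> F] --> c0 ->
  comb (p x) (c x) @[x --> F] --> comb p0 c0.
Proof.
move=> pp cc; apply: cvg_sum => -[e i] _; apply: cvgZ; last exact: pp.
exact: (cvg_comp _ _ cc (@coord_continuous R 2 n e i c0)).
Qed.

Lemma vimage_conic p v : vimage (conic p) v = normalize (p v).
Proof. by rewrite /vimage /conic comb_vpoint. Qed.

Lemma realK_sum_neq0 k : realK k -> k != 0.
Proof.
move=> /realKP[_ k1]; apply: contra_eq_neq k1 => ->.
by rewrite big1 1?eq_sym ?oner_eq0// => v _; rewrite mxE.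
Qed.

Section Injective.
Variable p : vertex -> V.
Hypothesis pinj : comb_injective p.

Lemma comb_neq0 c : admissible c -> c != 0 -> comb p c != 0.
Proof.
move=> ca; apply: contraNneq => pc0; apply/eqP.
by apply: pinj => //; [exact: admissible0|rewrite comb0].
Qed.

Lemma vertex_neq0 v : p v != 0.
Proof.
have vK := vpoint_realK (R := R) v; rewrite -comb_vpoint.
apply: comb_neq0; last exact: realK_sum_neq0.
by have /realKP[] := vK.
Qed.

Lemma conic_sphere k : realK k -> sphere (conic p k).
Proof.
move=> kK; apply/normalize_sphere/comb_neq0; last exact: realK_sum_neq0.
by have /realKP[] := kK.
Qed.

(** Turns coordinates with respect to the normalized vectors into coordinates
    with respect to the vectors [p v]. *)
Definition rescale c : coefs := \matrix_(e, i) ((Num.sqrt (dot (p (e, i)) (p (e, i))))^-1 * c e i).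

Lemma comb_vimage_conic c : comb (vimage (conic p)) c = comb p (rescale c).
Proof.
apply: eq_bigr => -[e i] _; rewrite vimage_conic /normalize scalerA mulrC.
by rewrite mxE.
Qed.

Lemma rescale_factor e i : 0 < (Num.sqrt (dot (p (e, i)) (p (e, i))))^-1.
Proof. by rewrite invr_gt0 sqrt_dot_gt0 vertex_neq0. Qed.

Lemma admissible_rescale c : admissible c -> admissible (rescale c).
Proof.
move=> [c0 cc]; split => [e i|i]; rewrite !mxE.
  by rewrite mulr_ge0// ltW// rescale_factor.
by case: (cc i) => ->; rewrite mulr0; [left|right].
Qed.

Lemma vsupport_rescale c : vsupport (rescale c) = vsupport c.
Proof.
apply/finset.setP => -[e i]; rewrite !in_vsupport mxE.
by rewrite mulf_eq0 gt_eqF// rescale_factor.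
Qed.

Lemma vimage_conic_injective : comb_injective (vimage (conic p)).
Proof.
move=> c d ca da; rewrite !comb_vimage_conic => cd.
have := pinj (admissible_rescale ca) (admissible_rescale da) cd.
move=> /matrixP cd'; apply/matrixP => e i; have := cd' e i; rewrite !mxE.
by apply: mulfI; rewrite gt_eqF// rescale_factor.
Qed.

Lemma conic_faces : spherical_faces (conic p).
Proof.
move=> s ss; apply/seteqP; split=> [_ [k [kK ks] <-]|y].
  have /realKP[ka _] := kK.
  have pk0 : comb p k != 0 by apply: comb_neq0 => //; exact: realK_sum_neq0.
  apply/hullP => //; split; first exact: conic_sphere.
  pose a := (Num.sqrt (dot (comb p k) (comb p k)))^-1.
  have a0 : 0 < a by rewrite invr_gt0 sqrt_dot_gt0.
  pose c : coefs := \matrix_(e, i) (Num.sqrt (dot (p (e, i)) (p (e, i))) * (a * k e i)).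
  have cE : rescale c = a *: k.
    apply/matrixP => e i; rewrite !mxE mulKf// gt_eqF// sqrt_dot_gt0.
    exact: vertex_neq0.
  have cs : vsupport c \subset s.
    rewrite -vsupport_rescale cE; apply/vsupport_sub => e i es; rewrite mxE.
    by move/vsupport_sub: ks => ->//; rewrite mulr0.
  exists c; split => //; last by rewrite comb_vimage_conic cE combZ.
  apply: simplex_admissible ss cs _ => e i; rewrite mxE.
  by rewrite mulr_ge0 ?sqrtr_ge0// mulr_ge0 ?(ltW a0)//; case: ka.
move=> /(hullP _ _ ss)[ys [c [ca cs yE]]].
pose d := rescale c; have da : admissible d by exact: admissible_rescale.
have yd : y = comb p d by rewrite yE comb_vimage_conic.
have d0 : d != 0.
  by apply: contraTneq (sphere_neq0 ys) => d0; rewrite yd d0 comb0 eqxx.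
pose S := \sum_(v : vertex) d v.1 v.2.
have S0 : 0 < S.
  rewrite lt_def sumr_ge0 ?andbT; last by move=> v _; case: da.
  apply: contra d0; rewrite psumr_eq0; last by move=> v _; case: da.
  move=> /allP d0; apply/eqP/matrixP => e i; rewrite [RHS]mxE; apply/eqP.
  by have := d0 (e, i) (mem_index_enum _).
have S0i : 0 < S^-1 by rewrite invr_gt0.
exists (S^-1 *: d); last by rewrite /conic combZ normalizeZ// -yd normalize_id.
split.
  apply/realKP; split; first by apply: admissibleZ => //; exact: ltW.
  under eq_bigr do rewrite mxE.
  by rewrite -mulr_sumr mulVf// gt_eqF.
apply: fintype.subset_trans cs; rewrite -vsupport_rescale -/d.
apply/vsupport_sub => e i; rewrite in_vsupport negbK => /eqP de.
by rewrite !mxE de !mulr0.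
Qed.

Lemma conic_continuous k : realK k -> {for k, continuous (conic p)}.
Proof.
move=> kK; have k0 : comb p k != 0.
  by apply: comb_neq0; [have /realKP[] := kK|exact: realK_sum_neq0].
have kc : comb p x @[x --> k] --> comb p k.
  exact: (cvg_comb (F := nbhs k) (p := fun=> p) (c := id) (fun=> cvg_cst _) cvg_id).
exact: (cvg_normalize k0 kc).
Qed.

(** The inverse reads off the coordinates in the fan and makes their sum 1. *)
Lemma conic_homeo (D : V -> coefs) (A : set coefs) : continuous D ->
  (forall c, admissible c -> D (comb p c) = c) -> A `<=` realK ->
  homeo_onto A (conic p @` A) (conic p).
Proof.
move=> Dc DP AK.
pose S y := \sum_(v : vertex) D y v.1 v.2.
have Dconic k : realK k -> exists2 a : R, 0 < a & D (conic p k) = a *: k.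
  move=> kK; have /realKP[ka _] := kK.
  exists (Num.sqrt (dot (comb p k) (comb p k)))^-1.
    rewrite invr_gt0 sqrt_dot_gt0; apply: comb_neq0 => //.
    exact: realK_sum_neq0.
  rewrite /conic /normalize -combZ DP//.
  by apply: admissibleZ => //; rewrite invr_ge0 sqrtr_ge0.
have SE k a : realK k -> D (conic p k) = a *: k -> S (conic p k) = a.
  move=> /realKP[_ k1] DE; rewrite /S DE.
  under eq_bigr do rewrite mxE.
  by rewrite -mulr_sumr k1 mulr1.
split => //.
  by apply: continuous_in_subspaceT => k /[!inE] /AK; exact: conic_continuous.
exists (fun y => (S y)^-1 *: D y); split; last first.
  move=> k /AK kK; have [a a0 DE] := Dconic k kK.
  by rewrite (SE k a kK DE) DE scalerA mulVf ?gt_eqF// scale1r.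
apply: continuous_in_subspaceT => y /[!inE] -[k /AK kK yE].
have [a a0 DE] := Dconic k kK; have Sa := SE k a kK DE; rewrite yE in Sa.
have Sc : S x @[x --> y] --> S y.
  apply: (@cvg_sum _ _ (nbhs y) _ R^o) => -[e i] _.
  exact: (cvg_comp _ _ (Dc y) (@coord_continuous R 2 n e i (D y))).
have S0 : S y != 0 by rewrite Sa gt_eqF.
exact: (cvgZ (cvgV S0 Sc) (Dc y)).
Qed.

End Injective.
End Conic.

(** * Indecomposability *)

Section Facets.
Context {n : nat}.
Notation vertex := (@vertex n).
Implicit Types (s t : {set vertex}) (e f g : {ffun 'I_n -> 'I_2}).

Definition facet e : {set vertex} := [set (e i, i) | i : 'I_n]%SET.

Lemma in_facet e a i : ((a, i) \in facet e) = (a == e i).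
Proof.
by apply/imsetP/eqP => [[j _ [-> <-]]//|->]; exists i.
Qed.

Lemma card_facet e : #|facet e| = n.
Proof. by rewrite card_imset ?card_ord// => i j []. Qed.

Lemma simplex_facet e : (0 < n)%N -> simplex (facet e).
Proof.
move=> n0; apply/andP; split; first by rewrite -card_gt0 card_facet.
apply/forallP => i; rewrite !in_facet; apply/negP => /andP[/eqP <-].
by rewrite eq_sym.
Qed.

Lemma ord2P (a : 'I_2) : {a = 0} + {a = 1}.
Proof. by case: a => -[|[|//]] ?; [left|right]; exact: val_inj. Qed.

Lemma full_simplex_facet s : (0 < n)%N -> simplex s -> #|s| = n ->
  exists e, s = facet e.
Proof.
move=> n0 ss sn; pose e := [ffun i => if (1, i) \in s then 1 else 0 : 'I_2].
exists e; apply/eqP; rewrite eqEcard card_facet sn leqnn andbT.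
apply/fintype.subsetP => -[a i] ais; rewrite in_facet ffunE.
case: (ord2P a) ais => -> ais; last by rewrite ais.
have /andP[_ /forallP/(_ i)] := ss; rewrite ais /= => /negbTE ->.
by [].
Qed.

Definition update e j a : {ffun 'I_n -> 'I_2} :=
  [ffun i => if i == j then a else e i].

(** Choices that agree on the forbidden coordinates are joined by changing the
    allowed coordinates one by one. *)
Lemma update_walk (allowed : pred 'I_n) (Q : {ffun 'I_n -> 'I_2} -> Prop) e f :
  (forall i, ~~ allowed i -> f i = e i) -> Q e ->
  (forall g j, allowed j -> Q g -> Q (update g j (f j))) -> Q f.
Proof.
move=> fe Qe step.
pose h k := [ffun i : 'I_n => if (i < k)%N then f i else e i].
have hn : h n = f by apply/ffunP => i; rewrite ffunE ltn_ord.
have h0 : h 0%N = e by apply/ffunP => i; rewrite ffunE ltn0.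
rewrite -hn; elim: {-2}n (leqnn n) => [|k IH] kn; first by rewrite h0.
have Qk := IH (ltnW kn); pose j := Ordinal kn.
have hS : h k.+1 = update (h k) j (f j).
  apply/ffunP => i; rewrite !ffunE ltnS leq_eqVlt.
  by rewrite -[i == j]/(val i == k); case: eqP => // ik; rewrite (_ : i = j)//; exact: val_inj.
have [aj|naj] := boolP (allowed j); first by rewrite hS; exact: step.
suff -> : h k.+1 = h k by [].
rewrite hS; apply/ffunP => i; rewrite !ffunE; case: eqP => // ->.
by rewrite ltnn fe.
Qed.

End Facets.

Section Indecomposable.
Context {R : realType} {n : nat}.
Notation V := 'rV[R]_n.+1.
Notation coefs := 'M[R]_(2, n).
Notation vertex := (@vertex n).
Implicit Types (e f g : {ffun 'I_n -> 'I_2}).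

(** Facets of the two subcomplexes share only vertices in the small plane [L],
    and no facet has all its vertices there. Hence, once two adjacent facets
    on different sides differ at the coordinate [i], changing another
    coordinate of both never moves them to the other side. So all facets with
    one choice at [i] lie on one side and those with the other choice on the
    other side, and [L] contains all vertices except the two of index [i]. *)
Lemma indecomposable (P : coefs -> V) (C1 C2 : {set {set vertex}}) : (1 < n)%N ->
  comb_injective (vimage P) ->
  (forall i j (L : {vspace V}), j != i ->
     (forall k, k != i -> vimage P (0, k) \in L) -> vimage P (1, j) \in L ->
     (n <= \dim L)%N) ->
  subcomplex C1 -> subcomplex C2 -> full_dim C1 -> full_dim C2 ->
  (forall s, simplex s -> (s \in C1) || (s \in C2)) ->
  ~ in_plane n.-1 (P @` (realC C1 `&` realC C2)).
Proof.
move=> n1 Pinj Pgen [sC1 cC1] [sC2 cC2] [s1 s1C s1n] [s2 s2C s2n] cov [L [Ld LP]].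
have n0 : (0 < n)%N := ltnW n1.
have Llt : (\dim L < n)%N by rewrite Ld prednK.
have shared e f i : facet e \in C1 -> facet f \in C2 -> e i = f i ->
    vimage P (e i, i) \in L.
  move=> eC fC ef; apply: LP; exists (vpoint (e i, i)) => //.
  have vK := vpoint_realK (R := R) (e i, i).
  have vs : vsupport (vpoint (e i, i) : coefs) = [set (e i, i)]%SET.
    apply/finset.setP => -[a j]; rewrite in_vsupport !inE mxE xpair_eqE.
    by case: andP => _; rewrite ?oner_eq0 ?eqxx.
  have v0 : [set (e i, i)]%SET != finset.set0 :> {set vertex}.
    by apply/set0Pn; exists (e i, i); rewrite inE.
  split; split => //; rewrite vs; [apply: (cC1 _ _ eC)|apply: (cC2 _ _ fC)] => //.
    by rewrite finset.sub1set in_facet.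
  by rewrite finset.sub1set in_facet ef.
have notall e : ~ forall i, vimage P (e i, i) \in L.
  move=> eL; suff : (n <= \dim L)%N by rewrite leqNgt Llt.
  rewrite -[leqLHS](card_facet e).
  apply: (@card_independent _ _ (vimage P)).
    by move=> c; apply: face_independent => //; exact: simplex_facet.
  by move=> [a i]; rewrite in_facet => /eqP ->.
have excl e : facet e \in C1 -> facet e \in C2 -> False.
  by move=> e1 e2; apply: (notall e) => i; exact: shared e1 e2 _.
have C12 e : facet e \notin C2 -> facet e \in C1.
  by move=> ne; have := cov _ (simplex_facet e n0); rewrite (negbTE ne) orbF.
have C21 e : facet e \notin C1 -> facet e \in C2.
  by move=> ne; have := cov _ (simplex_facet e n0); rewrite (negbTE ne).
have [f1 f1E] := full_simplex_facet n0 (sC1 _ s1C) s1n.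
have [f2 f2E] := full_simplex_facet n0 (sC2 _ s2C) s2n.
rewrite {s1 s1n}f1E in s1C; rewrite {s2 s2n}f2E in s2C.
(* two adjacent facets on different sides *)
have [e [i [b [eC1 eC2]]]] : exists e i b,
    facet e \in C1 /\ facet (update e i b) \in C2.
  apply: contrapT => nocut; apply: (excl f2) => //.
  apply: (@update_walk _ predT (fun e => facet e \in C1) f1) => // g j _ gC1.
  by apply: C12; apply/negP => gC2; apply: nocut; exists g, j, (f2 j).
pose cut g := [/\ g i = e i, facet g \in C1 & facet (update g i b) \in C2].
have cut_shared g k : cut g -> k != i -> vimage P (g k, k) \in L.
  by move=> [_ g1 g2] ki; apply: shared g1 g2 _; rewrite ffunE (negbTE ki).
have cut_step g j a : j != i -> cut g -> cut (update g j a).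
  move=> ji cg; have [gi g1 g2] := cg.
  have gj : vimage P (g j, j) \in L by exact: cut_shared.
  have ij : i != j by rewrite eq_sym.
  split; first by rewrite ffunE (negbTE ij).
    apply: C12; apply/negP => u2; apply: (notall g) => k.
    have [->//|kj] := eqVneq k j.
    by apply: (shared _ _ _ g1 u2); rewrite ffunE (negbTE kj).
  apply: C21; apply/negP => u1; apply: (notall (update g i b)) => k.
  have [->|kj] := eqVneq k j; first by rewrite ffunE (negbTE ji).
  have kE : update (update g j a) i b k = update g i b k.
    by rewrite !ffunE (negbTE kj).
  by rewrite -kE; apply: shared u1 g2 _.
have cut_all f : f i = e i -> cut f.
  move=> fi; apply: (@update_walk _ (predC1 i) cut e) => //.
    by move=> k; rewrite negbK => /eqP ->.
  by move=> g j ji; exact: cut_step.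
have [j ji] : exists j : 'I_n, j != i.
  pose o0 := Ordinal n0; pose o1 := Ordinal n1.
  by have [<-|] := eqVneq o0 i; [exists o1|exists o0].
suff : (n <= \dim L)%N by rewrite leqNgt Llt.
apply: (Pgen i j) => // [k ki|].
  have := cut_shared [ffun k => if k == i then e i else 0] k.
  by rewrite ffunE (negbTE ki); apply => //; apply: cut_all; rewrite ffunE eqxx.
have := cut_shared [ffun k => if k == i then e i else 1] j.
by rewrite ffunE (negbTE ji); apply => //; apply: cut_all; rewrite ffunE eqxx.
Qed.

End Indecomposable.

(** * Reflections and orthonormal frames *)

Section Reflection.
Context {R : realType} {N : nat}.
Implicit Types x y w : 'rV[R]_N.

(** For [w = 0] this is the identity. *)
Definition refl w x := x - (2 * dot x w / dot w w) *: w.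

Lemma refl_linear w : linear (refl w).
Proof.
move=> a x y; rewrite /refl dotDl dotZl scalerBr scalerA.
rewrite [RHS]addrACA -opprD -scalerDl; congr (_ - _ *: _).
by ring.
Qed.

HB.instance Definition _ w :=
  GRing.isLinear.Build R 'rV[R]_N 'rV[R]_N *:%R (refl w) (refl_linear w).

Lemma dot_refl w x y : dot (refl w x) (refl w y) = dot x y.
Proof.
rewrite /refl dotBl !dotBr !dotZl !dotZr (dotC w y).
have [->|w0] := eqVneq w 0; first by rewrite !dot0r; ring.
have ww : dot w w != 0 by rewrite dot_eq0.
by field.
Qed.

Lemma reflK w x : refl w (refl w x) = x.
Proof.
have [->|w0] := eqVneq w 0; first by rewrite /refl !scaler0 !subr0.
have ww : dot w w != 0 by rewrite dot_eq0.
have d : dot (refl w x) w = - dot x w by rewrite /refl dotBl dotZl; field.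
by rewrite [LHS]/refl d mulrN mulNr scaleNr opprK /refl subrK.
Qed.

Lemma dot_reflC w x y : dot (refl w x) y = dot x (refl w y).
Proof. by rewrite -[LHS](dot_refl w) reflK. Qed.

Lemma cvg_reflection (T : Type) (F : set_system T) {FF : Filter F}
    (w f : T -> 'rV[R]_N) (w0 a : 'rV[R]_N) : w0 != 0 ->
  w x @[x --> F] --> w0 -> f x @[x --> F] --> a ->
  refl (w x) (f x) @[x --> F] --> refl w0 a.
Proof.
move=> w00 wc fc; apply: cvgB => //; apply: cvgZ => //.
apply: cvgM; first by apply: cvgM; [exact: cvg_cst|exact: cvg_dot].
by apply: cvgV; [rewrite dot_eq0|exact: cvg_dot].
Qed.

End Reflection.

Section Frame.
Context {R : realType} {n : nat}.
Notation V := 'rV[R]_n.+1.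

Definition orthonormal_frame (m : V) (e : 'I_n -> V) :=
  [/\ forall i j, dot (e i) (e j) = (i == j)%:R, forall i, dot (e i) m = 0 &
      forall x, x = \sum_i dot x (e i) *: e i + dot x m *: m].

(** The reflection exchanging [m] with a vector of the standard basis maps the
    rest of that basis to a frame. *)
Lemma orthonormal_frame_exists m : sphere m -> exists e, orthonormal_frame m e.
Proof.
move=> ms; pose d (k : 'I_n.+1) : V := delta_mx 0 k.
have dE (x : V) k : dot x (d k) = x 0 k.
  rewrite dotE (bigD1 k)//= mxE !eqxx mulr1 big1 ?addr0// => j jk.
  by rewrite mxE (negbTE jk) andbF mulr0.
have dd k l : dot (d k) (d l) = (k == l)%:R by rewrite dE mxE eqxx eq_sym.
pose w := m - d 0.
have d0m : refl w (d 0) = m.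
  have [w0|w0] := eqVneq w 0.
    by rewrite w0 /refl scaler0 subr0; apply/esym/eqP; rewrite -subr_eq0 -/w w0.
  have ww : dot w w = 2 * (1 - dot (d 0) m).
    by rewrite /w dotBl !dotBr (dotC m) [dot m m]ms dd eqxx /=; ring.
  have : dot w w != 0 by rewrite dot_eq0.
  rewrite ww => nz; rewrite /refl ww {1}/w dotBr dd eqxx.
  rewrite (_ : _ / _ = - 1) ?scaleN1r ?opprK /w ?subrKC//.
  have nz' : 1 - dot (d 0) m != 0 by move: nz; rewrite mulf_eq0 negb_or => /andP[].
  by rewrite -(opprB 1) mulrN mulNr mulfV// mulf_neq0.
exists (fun i => refl w (d (lift 0 i))); split => [i j|i|x].
- by rewrite dot_refl dd (inj_eq lift_inj).
- by rewrite -d0m dot_refl dd.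
rewrite -{1}(reflK w x) {1}(row_sum_delta (refl w x)) linear_sum big_ord_recl addrC.
rewrite !linearZ /=; congr (_ + _).
  by apply: eq_bigr => i _; rewrite linearZ /= -dE dot_reflC.
by rewrite -dE dot_reflC d0m.
Qed.

End Frame.

(** * The fan of the coordinate cross-polytope *)

Section CoordinateFan.
Context {R : realType} {n : nat}.
Notation V := 'rV[R]_n.+1.
Notation coefs := 'M[R]_(2, n).
Notation vertex := (@vertex n).

Lemma sum_vertex (W : nmodType) (F : 'I_2 -> 'I_n -> W) :
  \sum_(v : vertex) F v.1 v.2 = \sum_i (F 0 i + F 1 i).
Proof.
rewrite -(pair_bigA _ F) /= big_ord_recl big_ord1 -big_split.
by apply: eq_bigr => i _; congr (_ + F _ i); exact: val_inj.
Qed.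

Variables (m : V) (e : 'I_n -> V).
Hypothesis frame : orthonormal_frame m e.

Definition axis (v : vertex) : V := if v.1 == 0 then - e v.2 else e v.2.

Definition axis_coef (x : V) : coefs :=
  \matrix_(a, i) Num.max (if a == 0 then - dot x (e i) else dot x (e i)) 0.

Lemma dot_comb_axis c i : dot (comb axis c) (e i) = c 1 i - c 0 i.
Proof.
have [ee _ _] := frame; rewrite dot_comb.
rewrite (sum_vertex (fun a j => c a j * dot (axis (a, j)) (e i))).
rewrite (bigD1 i)//= big1 ?addr0 => [|j ji].
  by rewrite /axis /= dotNl ee eqxx /=; ring.
by rewrite /axis /= dotNl ee (negbTE ji) /=; ring.
Qed.

Lemma axis_fan : fan_coordinates m axis axis_coef n.+1%:R.
Proof.
have [ee em ex] := frame.
have worth v : dot (axis v) m = 0 by rewrite /axis; case: ifP; rewrite ?dotNl em ?oppr0.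
split => //.
- move=> x; split => [a i|i]; first by rewrite mxE le_max lexx orbT.
  rewrite !mxE /=; case: (leP 0 (dot x (e i))) => h; [left|right].
    by rewrite ?max_r//; lra.
  by rewrite ?max_r//; lra.
- move=> x; rewrite {1}[x]ex; congr (_ + _).
  rewrite /comb (sum_vertex (fun a j => axis_coef x a j *: axis (a, j))).
  apply: eq_bigr => i _; rewrite !mxE /axis /= scalerN -scaleNr -scalerDl.
  congr (_ *: _); case: (leP (- dot x (e i)) 0) => h; case: (leP (dot x (e i)) 0) => h'; lra.
- move=> c h [c0 cc]; apply/matrixP => a i; rewrite mxE dotDl dot_comb_axis.
  rewrite dotZl (dotC m) em mulr0 addr0.
  have := c0 0 i; have := c0 1 i; have := cc i.
  case: (ord2P a) => -> /= [] -> => h1 h2.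
  + by rewrite max_r//; lra.
  + by rewrite sub0r opprK max_l.
  + by rewrite subr0 max_l.
  + by rewrite max_r//; lra.
- move=> x y a i; rewrite !mxE.
  have maxL (s t : R) : `|Num.max s 0 - Num.max t 0| <= `|s - t|.
    by case: (leP s 0) => h; case: (leP t 0) => h'; rewrite ?subrr ?normr0// ler_norml;
      have := ler_norm (s - t); have := ler_norm (t - s); rewrite (distrC t) => h1 h2;
      apply/andP; split; lra.
  apply: le_trans (maxL _ _) _.
  have -> : `|(if a == 0 then - dot x (e i) else dot x (e i)) -
      (if a == 0 then - dot y (e i) else dot y (e i))| = `|dot (x - y) (e i)|.
    by rewrite dotBl; case: ifP => // _; rewrite -opprB -normrN; congr `|_|; ring.
  apply: le_trans (dot_le_norm _ _) _; apply: ler_wpM2l => //.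
  rewrite -[leRHS]mulr1; apply: ler_pM => //; apply: sphere_norm_le1.
  by rewrite /sphere /= ee eqxx.
Qed.

End CoordinateFan.

Section PerturbedFan.
Context {R : realType} {n : nat}.
Notation V := 'rV[R]_n.+1.
Notation coefs := 'M[R]_(2, n).
Notation vertex := (@vertex n).

(** The homeomorphism of [perturbed_fan] preserves the heights here, so the
    perturbed cones still cover the equatorial hyperplane. *)
Lemma perturbed_conic_fan (m : V) (w p : vertex -> V) (coef : V -> coefs)
    (K eps : R) : (0 < n)%N -> sphere m -> fan_coordinates m w coef K ->
  (forall v, `|p v - w v| <= eps) -> (n.*2)%:R * (K * eps) <= 2^-1 ->
  (forall v, dot (p v) m = 0) ->
  exists coef' K', fan_coordinates m (vimage (conic p)) coef' K'.
Proof.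
move=> n0 ms fan close small pm.
have pinj : comb_injective p by move=> c d; exact: (perturbed_comb_inj fan close small).
apply: complete_fan_coordinates => //.
- by move=> v; rewrite vimage_conic dotZl pm mulr0.
- exact: vimage_conic_injective.
move=> x xm; have [E [E1 _ _]] := perturbed_fan fan close small.
have [d0 dd] : admissible (coef (E x)) by exact: fan_admissible fan _.
have xE : x = comb p (coef (E x)).
  have := E1 x; have pcm : dot (comb p (coef (E x))) m = 0.
    by rewrite dot_comb big1// => v _; rewrite pm mulr0.
  move=> /[dup] /(congr1 (dot^~ m)); rewrite dotDl dotZl pcm xm [dot m m]ms.
  by rewrite mulr1 add0r => <-; rewrite scale0r addr0.
exists (\matrix_(a, i) (Num.sqrt (dot (p (a, i)) (p (a, i))) * coef (E x) a i)).
  split => [a i|i]; rewrite !mxE; first by rewrite mulr_ge0 ?sqrtr_ge0.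
  by case: (dd i) => ->; rewrite !mulr0; [left|right].
rewrite comb_vimage_conic [LHS]xE; congr comb.
apply/matrixP => a i; rewrite !mxE mulKf// gt_eqF// sqrt_dot_gt0.
exact: (vertex_neq0 pinj).
Qed.

End PerturbedFan.

(** * An explicit flexible cross-polytope *)

Section HalfAngle.
Context {R : realType}.
Implicit Types a b t u : R.

(** Cosine and sine of the angle whose half has tangent [t]. *)
Definition cosT t := (1 - t ^+ 2) / (1 + t ^+ 2).
Definition sinT t := 2 * t / (1 + t ^+ 2).

Lemma onesqr_gt0 t : 0 < 1 + t ^+ 2.
Proof. by rewrite ltr_wpDr// sqr_ge0. Qed.

Lemma onesqr_neq0 t : 1 + t ^+ 2 != 0.
Proof. by rewrite gt_eqF// onesqr_gt0. Qed.

Lemma cosT_sinT t : cosT t ^+ 2 + sinT t ^+ 2 = 1.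
Proof. by rewrite /cosT /sinT; have := onesqr_neq0 t => h; field. Qed.

(** With half-angle tangents in the constant ratio [a : b], the term
    [sinT (a u) * sinT (b u)] is a multiple of the difference of cosines. *)
Lemma half_angle_flexion a b u : a ^+ 2 - b ^+ 2 != 0 ->
  2 * a * b / (a ^+ 2 - b ^+ 2) * (cosT (a * u) - cosT (b * u)) +
    sinT (a * u) * sinT (b * u) = 0.
Proof.
move=> ab; have ha := onesqr_neq0 (a * u); have hb := onesqr_neq0 (b * u).
by rewrite /cosT /sinT; field; rewrite ha hb ab.
Qed.

Lemma cosT_inj t u : 0 < t -> 0 < u -> cosT t = cosT u -> t = u.
Proof.
move=> t0 u0 /eqP; rewrite /cosT eqr_div ?onesqr_neq0// => /eqP h.
have : t ^+ 2 = u ^+ 2 by lra.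
by move=> /eqP; rewrite eqf_sqr => /orP[/eqP //|/eqP tu]; lra.
Qed.

Lemma cosT_le1 t : cosT t <= 1.
Proof. by rewrite /cosT ler_pdivrMr ?onesqr_gt0//; have := sqr_ge0 t; lra. Qed.

Lemma sinT_gt0 t : 0 < t -> 0 < sinT t.
Proof. by move=> t0; rewrite divr_gt0 ?onesqr_gt0// mulr_gt0. Qed.

Lemma sinT_ge t : 0 <= t <= 1 -> t <= sinT t.
Proof.
by move=> /andP[t0 t1]; rewrite /sinT ler_pdivlMr ?onesqr_gt0//; nra.
Qed.

Lemma cosT0 : cosT 0 = 1.
Proof. by rewrite /cosT expr0n subr0 addr0 divr1. Qed.

Lemma sinT0 : sinT 0 = 0.
Proof. by rewrite /sinT mulr0 mul0r. Qed.

Lemma cosT_continuous : continuous cosT.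
Proof.
move=> t; have sc : x ^+ 2 @[x --> t] --> t ^+ 2 by exact: (cvgM cvg_id cvg_id).
apply: (cvgM (cvgB (cvg_cst _) sc)).
by apply: cvgV; [exact: onesqr_neq0|exact: (cvgD (cvg_cst _) sc)].
Qed.

Lemma sinT_continuous : continuous sinT.
Proof.
move=> t; have sc : x ^+ 2 @[x --> t] --> t ^+ 2 by exact: (cvgM cvg_id cvg_id).
apply: (cvgM (cvgM (cvg_cst _) cvg_id)).
by apply: cvgV; [exact: onesqr_neq0|exact: (cvgD (cvg_cst _) sc)].
Qed.

End HalfAngle.

Section Family.
Context {R : realType} {n : nat}.
Notation V := 'rV[R]_n.+1.
Notation coefs := 'M[R]_(2, n).
Notation vertex := (@vertex n).
Variables (m : V) (e : 'I_n -> V) (L : R).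
Hypothesis ms : sphere m.
Hypothesis frame : orthonormal_frame m e.
Hypothesis L2 : 2 <= L.
Implicit Types (i j k : 'I_n) (u s : R) (v : vertex).

Let ee i j : dot (e i) (e j) = (i == j)%:R. Proof. by case: frame. Qed.
Let em i : dot (e i) m = 0. Proof. by case: frame. Qed.

Let L1 : 1 <= L. Proof. by apply: le_trans L2; lra. Qed.

Definition lam i := L ^+ i.
Definition gcoef i j := 2 * lam i * lam j / (lam i ^+ 2 - lam j ^+ 2).

Lemma lam_ge1 i : 1 <= lam i.
Proof. by apply: exprn_ege1; exact: L1. Qed.

Lemma lam_step i j : (j < i)%N -> L * lam j <= lam i.
Proof. by move=> ji; rewrite -exprS ler_weXn2l// L1. Qed.

Lemma lam_double i j : (j < i)%N -> 2 * lam j <= lam i.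
Proof.
move=> ji; apply: le_trans (lam_step ji); apply: ler_wpM2r L2.
exact: le_trans (lam_ge1 j).
Qed.

Lemma gcoefC i j : gcoef i j = - gcoef j i.
Proof.
rewrite /gcoef -(opprB (lam j ^+ 2)) invrN mulrN; congr (- (_ * _)).
by rewrite -!mulrA (mulrC (lam i)).
Qed.

Lemma gcoef_diag i : gcoef i i = 0.
Proof. by rewrite /gcoef subrr invr0 mulr0. Qed.

Lemma lam_sqrB_gt0 i j : (j < i)%N -> 0 < lam i ^+ 2 - lam j ^+ 2.
Proof.
move=> /lam_double h; have h1 := lam_ge1 j.
have : 2 * lam j * (2 * lam j) <= lam i * lam i by apply: ler_pM => //; lra.
have : 1 <= lam j * lam j by rewrite mulr_ege1.
lra.
Qed.

Lemma lam_sqrB_neq0 i j : i != j -> lam i ^+ 2 - lam j ^+ 2 != 0.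
Proof.
rewrite neq_ltn => /orP[ij|ji]; last by rewrite gt_eqF// lam_sqrB_gt0.
by rewrite -opprB oppr_eq0 gt_eqF// lam_sqrB_gt0.
Qed.

Lemma gcoef_le i j : `|gcoef i j| <= 4 / L.
Proof.
have h2 := L2; have L0 : 0 < L by lra.
wlog ji : i j / (j < i)%N => [h|].
  case: (ltngtP i j) => [ij|ji|/val_inj ->]; last by rewrite gcoef_diag normr0 divr_ge0//; lra.
  - by rewrite gcoefC normrN; exact: h.
  - exact: h.
have hp := lam_sqrB_gt0 ji; have hs := lam_step ji; have h1 := lam_ge1 j.
rewrite ger0_norm; last first.
  by rewrite divr_ge0 ?(ltW hp)// !mulr_ge0// exprn_ge0// ltW.
rewrite /gcoef ler_pdivrMr// [leRHS]mulrAC ler_pdivlMr//.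
have : lam i * (L * lam j) <= lam i * lam i by rewrite ler_wpM2l// exprn_ge0// ltW.
have hd := lam_double ji.
have : 2 * lam j * (2 * lam j) <= lam i * lam i by apply: ler_pM => //; lra.
lra.
Qed.

Definition off j : V := \sum_i gcoef i j *: e i.

Definition beta u j : V := off j + cosT (lam j * u) *: e j + sinT (lam j * u) *: m.

(** The vertices before the tilt, up to positive factors. *)
Definition gen u v : V := if v.1 == 0 then - e v.2 else beta u v.2.

Lemma dot_off i j : dot (off j) (e i) = gcoef i j.
Proof.
rewrite dot_suml (bigD1 i)//= dotZl ee eqxx mulr1 big1 ?addr0// => k ki.
by rewrite dotZl ee (negbTE ki) mulr0.
Qed.

Lemma dot_off_m j : dot (off j) m = 0.
Proof. by rewrite dot_suml big1// => k _; rewrite dotZl em mulr0. Qed.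

Lemma dot_beta_e u i j :
  dot (beta u j) (e i) = gcoef i j + cosT (lam j * u) * (j == i)%:R.
Proof. by rewrite !dotDl !dotZl dot_off ee (dotC m) em mulr0 addr0. Qed.

Lemma dot_beta_m u j : dot (beta u j) m = sinT (lam j * u).
Proof. by rewrite !dotDl !dotZl dot_off_m em [dot m m]ms mulr0 !add0r mulr1. Qed.

Lemma dot_beta u i j : dot (beta u i) (beta u j) = dot (off i) (off j) +
  (gcoef i j * (cosT (lam i * u) - cosT (lam j * u)) +
   sinT (lam i * u) * sinT (lam j * u)) +
  cosT (lam i * u) * cosT (lam j * u) * (i == j)%:R.
Proof.
rewrite {2}/beta !dotDr !dotZr dot_beta_e dot_beta_m.
rewrite /beta !dotDl !dotZl (dotC (e i)) dot_off (dotC m) dot_off_m.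
by rewrite (gcoefC j i); ring.
Qed.

(** Two vertices of index [i] and [j] both move only if they are of the second
    kind; the half-angle identity then cancels the two moving terms. *)
Lemma dot_gen_edge u u' v w : v.2 != w.2 ->
  dot (gen u v) (gen u w) = dot (gen u' v) (gen u' w).
Proof.
case: v w => [a i] [b j] /= ij; rewrite /gen /=; case: ifP => _; case: ifP => _ //.
- by rewrite !dotNl !(dotC (e i)) !dot_beta_e eq_sym (negbTE ij) !mulr0.
- by rewrite !dotNr !dot_beta_e (negbTE ij) !mulr0.
by rewrite !dot_beta (negbTE ij) !mulr0 /gcoef !half_angle_flexion// lam_sqrB_neq0.
Qed.

Lemma dot_beta_diag u j : dot (beta u j) (beta u j) = dot (off j) (off j) + 1.
Proof.
rewrite dot_beta gcoef_diag eqxx mul0r add0r mulr1 -addrA -!expr2.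
by rewrite [X in _ + X]addrC cosT_sinT.
Qed.

Lemma dot_gen_diag u u' v : dot (gen u v) (gen u v) = dot (gen u' v) (gen u' v).
Proof. by rewrite /gen; case: ifP => // _; rewrite !dot_beta_diag. Qed.

(** The vertices of the first kind, [- e i], all have the scalar product 1 with
    this vector. *)
Definition tilt_dir : V := - \sum_i e i.

Definition tilt s (x : V) : V := refl m (refl (m + s *: tilt_dir) x).

Lemma tilt_is_linear s : linear (tilt s).
Proof. by move=> a x y; rewrite /tilt !linearP. Qed.

HB.instance Definition _ s :=
  GRing.isLinear.Build R V V *:%R (tilt s) (tilt_is_linear s).

Lemma dot_tilt s x y : dot (tilt s x) (tilt s y) = dot x y.
Proof. by rewrite !dot_refl. Qed.

Lemma tilt_dir_m : dot tilt_dir m = 0.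
Proof. by rewrite dotNl dot_suml big1 ?oppr0. Qed.

Lemma tilt_dir_sqr : dot tilt_dir tilt_dir = n%:R.
Proof.
rewrite dotNl dotNr opprK dot_suml; under eq_bigr => i _.
  rewrite dot_sumr (bigD1 i)//= ee eqxx big1 ?addr0; last first.
    by move=> j ji; rewrite ee eq_sym (negbTE ji).
  over.
by rewrite sumr_const card_ord.
Qed.

Lemma tilt_axis_m s : dot (m + s *: tilt_dir) m = 1.
Proof. by rewrite dotDl dotZl tilt_dir_m mulr0 addr0. Qed.

Lemma tilt_axis_sqr s : dot (m + s *: tilt_dir) (m + s *: tilt_dir) = 1 + s ^+ 2 * n%:R.
Proof.
rewrite dotDr tilt_axis_m dotZr dotDl (dotC m) tilt_dir_m add0r dotZl.
by rewrite tilt_dir_sqr; ring.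
Qed.

Lemma tilt_axis_sqr_gt0 s : 0 < 1 + s ^+ 2 * n%:R :> R.
Proof. by rewrite ltr_wpDr// mulr_ge0// sqr_ge0. Qed.

Lemma tilt_axis_neq0 s : m + s *: tilt_dir != 0.
Proof. by rewrite -dot_gt0 tilt_axis_sqr tilt_axis_sqr_gt0. Qed.

Lemma tilt0 x : tilt 0 x = x.
Proof. by rewrite /tilt scale0r addr0 reflK. Qed.

Lemma tilt_height s x : (1 + s ^+ 2 * n%:R) * dot (tilt s x) m =
  (1 - s ^+ 2 * n%:R) * dot x m + 2 * s * dot x tilt_dir.
Proof.
have mm : refl m m = - m.
  by rewrite /refl [dot m m]ms mulr1 divr1 scaler_nat mulr2n opprD addrA subrr add0r.
rewrite /tilt dot_reflC mm dotNr /refl dotBl dotZl tilt_axis_m tilt_axis_sqr.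
rewrite dotDr dotZr; have h := tilt_axis_sqr_gt0 s.
by field; rewrite gt_eqF.
Qed.

(** With this factor the tilt lowers the vertices of the second kind by at most
    [u / 4], which is less than half of their height. *)
Definition ray u v : V := tilt (u / 16) (gen u v).

Lemma dot_ray u v w : dot (ray u v) (ray u w) = dot (gen u v) (gen u w).
Proof. exact: dot_tilt. Qed.

Lemma ray_continuous v : continuous (ray^~ v).
Proof.
move=> u; have sc : x / 16 @[x --> u] --> u / 16 by exact: (cvgM cvg_id (cvg_cst _)).
have wc : m + (x / 16) *: tilt_dir @[x --> u] --> m + (u / 16) *: tilt_dir.
  exact: (cvgD (cvg_cst _) (cvgZr_tmp sc)).
have gc : gen x v @[x --> u] --> gen u v.
  rewrite /gen; case: ifP => _; first exact: cvg_cst.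
  have lc : lam v.2 * x @[x --> u] --> lam v.2 * u by exact: (cvgM (cvg_cst _) cvg_id).
  have cc := cvg_comp _ _ lc (@cosT_continuous R (lam v.2 * u)).
  have ss := cvg_comp _ _ lc (@sinT_continuous R (lam v.2 * u)).
  exact: (cvgD (cvgD (cvg_cst _) (cvgZr_tmp cc)) (cvgZr_tmp ss)).
have tc : refl (m + (x / 16) *: tilt_dir) (gen x v) @[x --> u] -->
    refl (m + (u / 16) *: tilt_dir) (gen u v).
  exact: (@cvg_reflection _ _ _ (nbhs u) _ (fun x => m + (x / 16) *: tilt_dir)
    (gen^~ v) _ _ (tilt_axis_neq0 (u / 16)) wc gc).
have mc : cst m x @[x --> u] --> m by exact: cvg_cst.
exact: (@cvg_reflection _ _ _ (nbhs u) _ (cst m) _ _ _ (sphere_neq0 ms) mc tc).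
Qed.

Lemma ray0 v : ray 0 v = gen 0 v.
Proof. by rewrite /ray mul0r tilt0. Qed.

Lemma ray0_m v : dot (ray 0 v) m = 0.
Proof.
rewrite ray0 /gen; case: ifP => _; first by rewrite dotNl em oppr0.
by rewrite dot_beta_m mulr0 sinT0.
Qed.

Lemma ray0_axis v : `|ray 0 v - axis e v| <= n%:R * (4 / L).
Proof.
have h2 := L2; have L0 : 0 < L by lra.
rewrite ray0 /gen /axis; case: ifP => _.
  by rewrite subrr normr0 mulr_ge0// divr_ge0// ltW.
rewrite /beta mulr0 cosT0 sinT0 scale0r addr0 scale1r addrK.
apply: le_trans (ler_norm_sum _ _ _) _.
apply: (@le_trans _ _ (\sum_(i < n) 4 / L)).
  apply: ler_sum => i _; rewrite normrZ -[leRHS]mulr1; apply: ler_pM => //.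
    exact: gcoef_le.
  by apply: sphere_norm_le1; rewrite /sphere /= ee eqxx.
by rewrite sumr_const card_ord -[leLHS]mulr_natl.
Qed.

(** Tilting lifts the vertices on the equator, at a rate slower than the one
    at which the other vertices leave it. *)
Lemma ray_upper u v : n%:R * (4 / L) <= 1 -> 0 < u -> u <= 1 -> u * n%:R <= 1 ->
  (forall i, lam i * u <= 1) -> 0 < dot (ray u v) m.
Proof.
move=> nL u0 u1 un ul.
have s0 : 0 < u / 16 by lra.
have sn : (u / 16) ^+ 2 * n%:R <= 2^-1.
  rewrite (_ : _ * _ = u * (u * n%:R) / 256); last by field.
  have : u * (u * n%:R) <= 1.
    rewrite -[leRHS]mulr1; apply: ler_pM => //; first lra.
    by rewrite mulr_ge0//; lra.
  lra.
have := tilt_height (u / 16) (gen u v); rewrite -/(ray u v) => hE.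
rewrite -(pmulr_rgt0 _ (tilt_axis_sqr_gt0 (u / 16))) hE /gen.
case: v {hE} => a j /=; case: ifP => _.
  rewrite dotNl em oppr0 mulr0 add0r dotNl dotNr opprK dot_sumr.
  rewrite (bigD1 j)//= ee eqxx big1 ?addr0 ?mulr1; last first.
    by move=> i ij; rewrite ee eq_sym (negbTE ij).
  lra.
rewrite dot_beta_m dotNr dot_sumr.
have lu : u <= sinT (lam j * u).
  apply: (@le_trans _ _ (lam j * u)); first by rewrite ler_peMl ?lam_ge1// ltW.
  by apply: sinT_ge; rewrite ul mulr_ge0//; have := lam_ge1 j; lra.
have sum2 : \sum_i dot (beta u j) (e i) <= 2.
  under eq_bigr do rewrite dot_beta_e.
  have cE : \sum_i cosT (lam j * u) * (j == i)%:R = cosT (lam j * u).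
    rewrite (bigD1 j)//= eqxx mulr1 big1 ?addr0// => i ij.
    by rewrite eq_sym (negbTE ij) mulr0.
  rewrite big_split /= cE.
  have : \sum_i gcoef i j <= 1.
    apply: le_trans nL; apply: (@le_trans _ _ (\sum_(i < n) 4 / L)).
      by apply: ler_sum => i _; apply: le_trans (gcoef_le i j); exact: ler_norm.
    by rewrite sumr_const card_ord -[leLHS]mulr_natl.
  have := cosT_le1 (lam j * u); lra.
move: (sinT _) lu (\sum_i _) sum2 ((u / 16) ^+ 2 * _) sn => S lu B B2 q q2.
nra.
Qed.

End Family.

Section RayPolyhedra.
Context {R : realType} {n : nat}.
Notation V := 'rV[R]_n.+1.
Notation coefs := 'M[R]_(2, n).
Notation vertex := (@vertex n).
Variables (m : V) (e : 'I_n -> V) (L : R).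
Hypothesis ms : sphere m.
Hypothesis frame : orthonormal_frame m e.
Hypothesis L2 : 2 <= L.

Lemma dot_normalize N (x y : 'rV[R]_N) :
  dot (normalize x) (normalize y) =
  (Num.sqrt (dot x x))^-1 * ((Num.sqrt (dot y y))^-1 * dot x y).
Proof. by rewrite dotZl dotZr. Qed.

Lemma dot_vimage_ray u (v w : vertex) :
  dot (vimage (conic (ray m e L u)) v) (vimage (conic (ray m e L u)) w) =
  (Num.sqrt (dot (gen m e L u v) (gen m e L u v)))^-1 *
  ((Num.sqrt (dot (gen m e L u w) (gen m e L u w)))^-1 *
   dot (gen m e L u v) (gen m e L u w)).
Proof.
by rewrite (vimage_conic _ v) (vimage_conic _ w) dot_normalize
  (dot_ray m e L u v v) (dot_ray m e L u w w) (dot_ray m e L u v w).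
Qed.

Lemma dot_vimage_edge u u' (v w : vertex) : v.2 != w.2 ->
  dot (vimage (conic (ray m e L u)) v) (vimage (conic (ray m e L u)) w) =
  dot (vimage (conic (ray m e L u')) v) (vimage (conic (ray m e L u')) w).
Proof.
move=> vw; rewrite [LHS]dot_vimage_ray [RHS]dot_vimage_ray.
rewrite (dot_gen_diag L ms frame u u' v) (dot_gen_diag L ms frame u u' w).
by rewrite (dot_gen_edge ms frame L2 u u' vw).
Qed.

Lemma congruent_dot (P Q : coefs -> V) v w : congruent P Q ->
  dot (vimage Q v) (vimage Q w) = dot (vimage P v) (vimage P w).
Proof.
move=> [A [AA _ QP]]; rewrite !QP /dot trmx_mul mulmxA -(mulmxA _ A) AA.
by rewrite mulmx1.
Qed.

(** The parameter can be recovered from the distance between two opposite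
    vertices. *)
Lemma ray_not_congruent u u' : (0 < n)%N -> 0 < u -> 0 < u' ->
  congruent (conic (ray m e L u)) (conic (ray m e L u')) -> u = u'.
Proof.
move=> n0 u0 u'0 cuu; pose j := Ordinal n0; have [ee _ _] := frame.
have := etrans (esym (dot_vimage_ray u' (0, j) (1, j)))
  (etrans (congruent_dot (0, j) (1, j) cuu) (dot_vimage_ray u (0, j) (1, j))).
rewrite (dot_gen_diag L ms frame u u' (0, j)) (dot_gen_diag L ms frame u u' (1, j)).
have d1 w : dot (gen m e L w (0, j)) (gen m e L w (1, j)) = - cosT (lam L j * w).
  rewrite /gen /= dotNl dotC (dot_beta_e L frame) gcoef_diag eqxx mulr1 add0r.
  by [].
have pos a : 0 < (Num.sqrt (dot (gen m e L u' (a, j)) (gen m e L u' (a, j))))^-1.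
  rewrite invr_gt0 sqrtr_gt0 /gen; case: ifP => _ /=.
    by rewrite dotNl dotNr opprK ee eqxx.
  by rewrite (dot_beta_diag L ms frame) ltr_wpDl// dot_ge0.
rewrite !d1 => /mulfI-/(_ (lt0r_neq0 (pos 0)))/mulfI-/(_ (lt0r_neq0 (pos 1))).
have l0 : 0 < lam L j by apply: lt_le_trans (lam_ge1 L2 j).
move=> /oppr_inj/cosT_inj -/(_ (mulr_gt0 l0 u'0) (mulr_gt0 l0 u0)).
by move=> /mulfI -/(_ (lt0r_neq0 l0)) ->.
Qed.

Lemma comb_ray u c : comb (ray m e L u) c = tilt m e (u / 16) (comb (gen m e L u) c).
Proof. by rewrite /comb linear_sum; apply: eq_bigr => v _; rewrite linearZ. Qed.

(** The vertices [a_k] span a space of vectors without height before the tilt,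
    which contains no [b_j]. *)
Lemma ray_generic u (i j : 'I_n) (W : {vspace V}) : 0 < u ->
  comb_injective (ray m e L u) -> j != i ->
  (forall k, k != i -> vimage (conic (ray m e L u)) (0, k) \in W) ->
  vimage (conic (ray m e L u)) (1, j) \in W -> (n <= \dim W)%N.
Proof.
move=> u0 pinj ji W0 W1; have [ee em _] := frame.
pose s : {set vertex} := ((1, j) |: [set (0, k) | k in [set~ i]])%SET.
have in_s0 k : ((0, k) \in s) = (k != i).
  rewrite !inE xpair_eqE /=; apply/imsetP/idP => [[l] /[!inE] li [->] //|ki].
  by exists k; rewrite ?inE.
have in_s1 k : ((1, k) \in s) = (k == j).
  rewrite !inE xpair_eqE eqxx /=; case: eqP => //= _.
  by apply/negbTE/negP => /imsetP[l _ []].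
have sn : #|s| = n.
  rewrite cardsU1 card_imset; last by move=> k l [].
  rewrite cardsC1 card_ord (_ : _ \notin _); last first.
    by apply/negP => /imsetP[l _ []].
  by rewrite add1n prednK// (leq_ltn_trans _ (ltn_ord i)).
rewrite -[leqLHS]sn; apply: (@card_independent _ _ (vimage (conic (ray m e L u)))).
  move=> c cs; rewrite comb_vimage_conic; set d := rescale _ c.
  have ds : vsupport d \subset s by rewrite (vsupport_rescale pinj).
  rewrite comb_ray => td.
  have d0 : comb (gen m e L u) d = 0.
    by apply/eqP; rewrite -dot_eq0 -(dot_tilt m e (u / 16)) td dot0l.
  have d1 k : d 1 k = 0.
    have [->|kj] := eqVneq k j; last first.
      by move/vsupport_sub: ds; apply; rewrite in_s1.
    have : dot (comb (gen m e L u) d) m = 0 by rewrite d0 dot0l.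
    rewrite dot_comb (sum_vertex (fun a k => d a k * dot (gen m e L u (a, k)) m)).
    rewrite (bigD1 j)//= big1 ?addr0 => [|l lj].
      rewrite /gen /= dotNl em oppr0 mulr0 add0r (dot_beta_m L ms frame) => /eqP.
      rewrite mulf_eq0 => /orP[/eqP //|]; rewrite gt_eqF// sinT_gt0// mulr_gt0//.
      exact: lt_le_trans (lam_ge1 L2 j).
    rewrite /gen /= dotNl em oppr0 mulr0 add0r.
    by move/vsupport_sub: ds => ->; rewrite ?in_s1// mul0r.
  have d0k k : d 0 k = 0.
    have : dot (comb (gen m e L u) d) (e k) = 0 by rewrite d0 dot0l.
    rewrite dot_comb (sum_vertex (fun a l => d a l * dot (gen m e L u (a, l)) (e k))).
    rewrite (bigD1 k)//= big1 ?addr0 => [|l lk].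
      rewrite d1 mul0r addr0 /gen /= dotNl ee eqxx mulrN1 => /eqP.
      by rewrite oppr_eq0 => /eqP.
    by rewrite d1 mul0r addr0 /gen /= dotNl ee (negbTE lk) oppr0 mulr0.
  apply/eqP; rewrite -vsupport_eq0 -(vsupport_rescale pinj) vsupport_eq0.
  by apply/eqP/matrixP => a k; rewrite [RHS]mxE -/d; case: (ord2P a) => ->.
move=> [a k]; case: (ord2P a) => ->; first by rewrite in_s0; exact: W0.
by rewrite in_s1 => /eqP ->.
Qed.

End RayPolyhedra.

Section Existence.
Context {R : realType} {n : nat}.
Notation V := 'rV[R]_n.+1.
Notation coefs := 'M[R]_(2, n).
Notation vertex := (@vertex n).

Lemma edge_distinct_index (v w : vertex) :
  v != w -> simplex [set v; w]%SET -> v.2 != w.2.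
Proof.
case: v w => [a i] [b j] /= vw /andP[_ /forallP/(_ i)].
apply: contraNneq => ij; move: vw; rewrite -ij !inE !xpair_eqE !eqxx !andbT.
by case: (ord2P a) => ->; case: (ord2P b) => ->; rewrite ?eqxx.
Qed.

Lemma dist_le_half (W : normedModType R) (x y z : W) (a : R) :
  `|x - y| <= a / 2 -> `|x - z| <= a / 2 -> `|y - z| <= a.
Proof. by move=> xy xz; have := ler_distD x y z; rewrite (distrC y x); lra. Qed.

Lemma embedded_flexible_exists (m : V) : (1 < n)%N -> sphere m ->
  exists (P : R -> coefs -> V) (b : R),
    [/\ 0 < b, flexible [set u : R | 0 < u < b] P,
        forall u, 0 < u < b -> embedded (P u),
        forall u, 0 < u < b -> surface (P u) `<=` upper m &
        exists u1 u2 : R, [/\ 0 < u1 < b, 0 < u2 < b &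
          (sphere_volume (far_part m (P u1)) < sphere_volume (far_part m (P u2)))%E]].
Proof.
move=> n1 ms; have n0 : (0 < n)%N := ltnW n1.
have n0R : 0 < n%:R :> R by rewrite ltr0n.
have [e frame] := orthonormal_frame_exists ms; have [ee em _] := frame.
pose eps : R := 2^-1 / ((n.*2)%:R * n.+1%:R).
have d0 : 0 < (n.*2)%:R * n.+1%:R :> R by rewrite mulr_gt0 ?ltr0n// double_gt0.
have eps0 : 0 < eps by rewrite divr_gt0.
have small : (n.*2)%:R * (n.+1%:R * eps) <= 2^-1.
  by rewrite mulrA /eps mulrCA mulfV ?mulr1// gt_eqF.
(* the ratio of consecutive tangents: large enough for the equatorial position
   to be close to the coordinate cross-polytope *)
pose L : R := 2 + n%:R * 4 + n%:R * 8 / eps.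
have q0 : 0 <= n%:R * 8 / eps by rewrite !mulr_ge0// invr_ge0 ltW.
have L2 : 2 <= L by rewrite /L; lra.
have L0 : 0 < L by lra.
have nL1 : n%:R * (4 / L) <= 1 by rewrite mulrA ler_pdivrMr// /L; lra.
have nLe : n%:R * (4 / L) <= eps / 2.
  rewrite mulrA ler_pdivrMr//; have : n%:R * 8 / eps * eps = n%:R * 8 by rewrite divfK ?gt_eqF.
  have : 0 <= n%:R * 4 * eps by rewrite !mulr_ge0// ltW.
  rewrite /L; lra.
pose p := ray m e L.
have [r r0 rP] : exists2 r : R, 0 < r &
    forall u, `|u| < r -> forall v, `|p u v - axis e v| <= eps.
  have : \forall u \near (0 : R), forall v : vertex, `|p u v - axis e v| <= eps.
    apply: (@filter_forall R vertex _ (nbhs (0 : R))) => v.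
    have pc : p u v @[u --> (0 : R)] --> p 0 v by exact: ray_continuous.
    have e2 : 0 < eps / 2 by rewrite divr_gt0.
    near=> u; have h0 : `|p 0 v - axis e v| <= eps / 2 by apply: le_trans nLe; exact: ray0_axis.
    have hu : `|p 0 v - p u v| <= eps / 2.
      by near: u; exact: (@cvgr_dist_le _ _ _ _ _ _ _ pc _ e2).
    exact: dist_le_half hu h0.
  move=> /nbhs_ballP[r /= r0 rP]; exists r => // u ur v.
  by apply: rP; rewrite /ball /= sub0r normrN.
pose b := Num.min (Num.min r 1) (Num.min n%:R^-1 (L ^+ n)^-1).
have Ln0 : 0 < L ^+ n by rewrite exprn_gt0.
have b0 : 0 < b by rewrite !lt_min r0 ltr01 !invr_gt0 n0R Ln0.
have br (u : R) : 0 < u < b -> forall v, `|p u v - axis e v| <= eps.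
  move=> /andP[u0]; rewrite !lt_min => /andP[/andP[ur _] _]; apply: rP.
  by rewrite gtr0_norm.
have close0 : forall v, `|p 0 v - axis e v| <= eps by apply: rP; rewrite normr0.
have up (u : R) v : 0 < u < b -> 0 < dot (p u v) m.
  move=> /andP[u0]; rewrite !lt_min => /andP[/andP[_ u1] /andP[un uL]].
  apply: ray_upper => //; first exact: ltW.
    by rewrite -ler_pdivlMr// div1r ltW.
  move=> i; rewrite mulrC -ler_pdivlMr ?exprn_gt0// div1r ltW//.
  apply: lt_le_trans uL _; rewrite lef_pV2 ?posrE ?exprn_gt0//.
  by apply: ler_weXn2l; [lra|exact: ltnW].
have fan := axis_fan frame.
have pinj (u : R) : 0 < u < b -> comb_injective (p u).
  by move=> ub c d; exact: (perturbed_comb_inj fan (br u ub) small).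
pose P u := conic (p u).
have Ps (u : R) : 0 < u < b -> surface (P u) `<=` sphere.
  by move=> ub _ [k kK <-]; apply: conic_sphere => //; exact: pinj.
have homeo (u : R) A : 0 < u < b -> A `<=` realK -> homeo_onto A (P u @` A) (P u).
  move=> ub AK; have [D [Dc _ DP]] := perturbed_coef fan (br u ub) small.
  exact: (@conic_homeo _ _ _ (pinj u ub) D A Dc DP AK).
have Pf (u : R) : 0 < u < b -> spherical_faces (P u).
  by move=> ub; apply: conic_faces; exact: pinj.
have Pnd (u : R) : 0 < u < b -> nondegenerate_polyhedron (P u).
  move=> ub; have vinj := vimage_conic_injective (pinj u ub); split => //.
  - exact: Ps.
  - move=> s ss; split; first exact: comb_injective_general_position.
    by rewrite -Pf//; apply: homeo => // k [].
  - move=> C1 C2; apply: indecomposable => // i j W ji; have /andP[u0 _] := ub.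
    by apply: ray_generic => //; exact: pinj.
have Pu (u : R) : 0 < u < b -> surface (P u) `<=` upper m.
  move=> ub y Sy; split; first exact: (Ps u ub).
  have vn v : 0 < dot (vimage (P u) v) m.
    rewrite vimage_conic dotZl mulr_gt0 ?up// invr_gt0 sqrt_dot_gt0.
    by apply: vertex_neq0; exact: pinj.
  pose h := \big[Num.min/1]_v dot (vimage (P u) v) m.
  have h0 : 0 < h by apply: lt_bigmin => // v _.
  apply: (lt_le_trans h0); apply: (surface_ge (Pf u ub) (ltW h0)) Sy => v.
  split; last exact: bigmin_le_cond.
  by apply: (Ps u ub); exists (vpoint v) => //; exact: vpoint_realK.
exists P, b; split; [exact: b0| | |exact: Pu|].
- split.
  + split; last by move=> u ub; exact: Ps.
    apply: continuous_in_subspaceT => -[u k] /[!inE] -[/= ub kK].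
    have uc : z.1 @[z --> (u, k)] --> u by exact: cvg_fst.
    have kc : z.2 @[z --> (u, k)] --> k by exact: cvg_snd.
    have cc : comb (p z.1) z.2 @[z --> (u, k)] --> comb (p u) k.
      apply: (@cvg_comb _ _ _ (nbhs (u, k)) _ (fun z => p z.1) snd) => // v.
      have pc : p x v @[x --> u] --> p u v by exact: ray_continuous.
      exact: (cvg_comp _ _ uc pc).
    apply: cvg_normalize cc; apply: comb_neq0; first exact: pinj.
      by have /realKP[] := kK.
    exact: realK_sum_neq0.
  + rewrite (_ : [set u | _] = set0) ?finite_set0//.
    by rewrite -subset0 => u [ub]; apply; exact: Pnd.
  + move=> v w vw ss u1 u2 _ _; apply: (congr1 acos).
    exact: (dot_vimage_edge ms frame L2 u1 u2 (edge_distinct_index vw ss)).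
  + move=> u _; near=> u1 u2 => /andP[u10 _] /andP[u20 _] u12 cuu; apply: u12.
    exact: (ray_not_congruent ms frame L2 n0 u10 u20 cuu).
- by move=> u ub; exact: homeo.
have [coef' [K' fan']] := perturbed_conic_fan n0 ms fan close0 small (ray0_m L ms frame).
have e0s : sphere (e (Ordinal n0)) by rewrite /sphere /= ee eqxx.
have := volume_nonconstant (P := P) (u0 := b) ms e0s (em _) fan'.
case=> [eta eta0|u1 [u2 [h1 h2 _ h3]]]; last by exists u1, u2.
have : \forall u \near (0 : R), forall v : vertex,
    `|vimage (P u) v - vimage (conic (p 0)) v| <= eta.
  apply: (@filter_forall R vertex _ (nbhs (0 : R))) => v.
  have pc : normalize (p u v) @[u --> (0 : R)] --> normalize (p 0 v).
    have pc : p u v @[u --> (0 : R)] --> p 0 v by exact: ray_continuous.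
    apply: cvg_normalize pc; apply: vertex_neq0.
    by move=> c d; exact: (perturbed_comb_inj fan close0 small).
  near=> u; have : `|normalize (p 0 v) - normalize (p u v)| <= eta.
    by near: u; exact: (@cvgr_dist_le _ _ _ _ _ _ _ pc _ eta0).
  by rewrite distrC -(vimage_conic (p 0) v) -(vimage_conic (p u) v).
move=> /nbhs_ballP[r' /= r'0 r'P].
have m0 : 0 < Num.min r' b by rewrite lt_min r'0.
pose u := Num.min r' b / 2.
have uu : 0 < u by rewrite divr_gt0.
have um : u < Num.min r' b by rewrite /u; lra.
move: um; rewrite lt_min => /andP[ur' ub]; have ub' : 0 < u < b by rewrite uu.
exists u; split => //; [exact: Pf|exact: Pu|].
by apply: r'P; rewrite /ball /= sub0r normrN gtr0_norm.
Unshelve. all: by end_near. Qed.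

End Existence.

Theorem corollary1p2 (R : realType) (n : nat) (hn : (2 <= n)%N)
    (m : 'rV[R]_n.+1) (hm : sphere m) :
  (forall (P : one_point_compactification R -> 'M[R]_(2, n) -> 'rV[R]_n.+1)
      (delta : R),
    flexible [set: one_point_compactification R] P ->
    0 < delta ->
    (forall u : R, - delta < u < delta -> embedded (P (Some u))) ->
    homeo_onto realK (equator m) (P (Some 0)) ->
    (forall s : {set vertex}, simplex s ->
       general_position (P (Some 0)) s /\
       P (Some 0) @` face s = hull (vimage (P (Some 0))) s) ->
    (forall u : R, 0 < u -> surface (P (Some u)) `<=` upper m) ->
    (forall u : R, u < 0 -> surface (P (Some u)) `<=` lower m) ->
    surface (P None) `<=` equator m ->
    ~ embedded (P None) ->
    forall u0 : R, 0 < u0 -> u0 <= delta ->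
    exists u1 u2 : R, [/\ 0 < u1 < u0, 0 < u2 < u0 &
      sphere_volume (pole_part m (P (Some u1))) <>
      sphere_volume (pole_part m (P (Some u2)))]) /\
  (exists (P : R -> 'M[R]_(2, n) -> 'rV[R]_n.+1) (a b : R),
    [/\ a < b,
        flexible [set u : R | a < u < b] P,
        forall u : R, a < u < b -> embedded (P u),
        forall u : R, a < u < b -> surface (P u) `<=` upper m &
        exists u1 u2 : R, [/\ a < u1 < b, a < u2 < b &
          sphere_volume (far_part m (P u1)) <>
          sphere_volume (far_part m (P u2))]]).
Proof.
split=> [P delta flexP _ _ P0 P0f Pu _ _ _ u0 u00 _|].
  have [||u1 [u2 [h1 h2 h3]]] :=
    flexible_through_equator (ltnW hn) hm flexP P0 _ _ Pu u00.
  - by move=> s /P0f[].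
  - by move=> s /P0f[].
  by exists u1, u2; split => // veq; move: h3; rewrite veq ltxx.
have [P [b [b0 flexP embP upP [u1 [u2 [h1 h2 h3]]]]]] := embedded_flexible_exists hn hm.
exists P, 0, b; split => //; exists u1, u2; split => // veq.
by move: h3; rewrite veq ltxx.
Qed.
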